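(* Let $G$ be a finitely presented group. Then, for each $n\geq 2$, the kernel $\ker(\lambda_n^G)$ of the homomorphism $\lambda_n^G\colon G^{\otimes n}\to\gamma_n(G)$ is finitely generated.
   Context: Conventions: actions are on the right, $x^y = y^{-1}xy$, $[x,y]=x^{-1}y^{-1}xy = x^{-1}x^y$, and longer commutators are left-normed: $[x_1,\dots,x_k]=[[x_1,\dots,x_{k-1}],x_k]$. $\gamma_n(G)$ denotes the $n$-th term of the lower central series of $G$ ($\gamma_1(G)=G$, $\gamma_{k+1}(G)=[\gamma_k(G),G]$). Two groups $G$ and $H$, each acting on the other on the right and on itself by conjugation, act compatibly if for all $g,g_1\in G$, $h,h_1\in H$: $g^{(h^{g_1})} = ((g^{g_1^{-1}})^h)^{g_1}$ and $h^{(g^{h_1})} = ((h^{h_1^{-1}})^g)^{h_1}$. In that case the non-abelian tensor product $G\otimes H$ is the group generated by symbols $g\otimes h$ ($g\in G$, $h\in H$) subject to the relations $gg_1\otimes h = (g^{g_1}\otimes h^{g_1})(g_1\otimes h)$ and $g\otimes hh_1 = (g\otimes h_1)(g^{h_1}\otimes h^{h_1})$ for all $g,g_1\in G$, $h,h_1\in H$. The $n$-fold tensor product $G^{\otimes n}$ is defined inductively. $G^{\otimes 2}=G\otimes G$ is the non-abelian tensor product of $G$ with itself, all actions being conjugation. For $n\geq 3$, $G^{\otimes n} = G^{\otimes (n-1)}\otimes G$, where $G$ acts on $G^{\otimes (n-1)}$ diagonally, $(((g_1\otimes g_2)\otimes\dots)\otimes g_{n-1})^{g} = ((g_1^{g}\otimes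 g_2^{g})\otimes\dots)\otimes g_{n-1}^{g}$, and $G^{\otimes(n-1)}$ acts on $G$ by $g^{((g_2\otimes g_3)\otimes\dots)\otimes g_n} = g^{[g_2,g_3,\dots,g_n]}$. These actions are well defined and compatible. The homomorphism $\lambda_n^G\colon G^{\otimes n}\to\gamma_n(G)$ is the well-defined homomorphism given on generators by $((g_1\otimes g_2)\otimes\dots\otimes g_{n-1})\otimes g_n\mapsto [g_1,g_2,\dots,g_n]$. *)

(* Defs.v *)
From HB Require Import structures.
From mathcomp Require Import all_boot.
From mathcomp Require Import boolp classical_sets.

Set Implicit Arguments.
Unset Strict Implicit.
Unset Printing Implicit Defensive.

Local Open Scope quotient_scope.
Local Open Scope classical_set_scope.
Local Open Scope group_scope.

(* [groupType] is the library's structure of (possibly infinite) groups.  Its *)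
(* notations x ^ y = y^-1 * (x * y) and [~ x, y] = x^-1 * x ^ y follow the    *)
(* right-action conventions used here.                                        *)

(* Monoid morphisms between groups are exactly the group homomorphisms.       *)
Notation "{ 'hom' G -> H }" := (UMagmaMorphism.type G%type H%type)
  (at level 0, G at level 98, H at level 99, format "{ 'hom'  G  ->  H }") :
  type_scope.

Section Subgroups.
Variable G : groupType.
Implicit Types (S H : set G) (n : nat).

Definition is_subgroup H : Prop :=
  H 1 /\ (forall x y, H x -> H y -> H (x / y)).

Definition subgroup_gen S : set G := smallest is_subgroup S.

Definition finitely_generated H : Prop :=
  exists s : seq G, H = subgroup_gen [set` s].

Lemma subgroup_gen_subgroup S : is_subgroup (subgroup_gen S).
Proof.
split=> [P [[P1 _] _] //|x y Sx Sy P PP].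
by case: (PP) => -[_ PV] _; apply: PV; [apply: Sx | apply: Sy].
Qed.

Lemma subgroupM H x y : is_subgroup H -> H x -> H y -> H (x * y).
Proof.
move=> [H1 HV] Hx Hy; rewrite -[y]invgK; apply: (HV) => //.
by rewrite -[y^-1]mul1g; apply: HV.
Qed.

Lemma subgroupV H x : is_subgroup H -> H x -> H x^-1.
Proof. by move=> [H1 HV] Hx; rewrite -[x^-1]mul1g; apply: HV. Qed.

Fixpoint lower_central_rec n : set G :=
  if n is m.+1 then
    subgroup_gen [set [~ x, y] | x in lower_central_rec m & y in [set: G]]
  else [set: G].

(* The n-th term gamma_n(G), with gamma_1(G) = G; the index 0 is junk.        *)
Definition lower_central n : set G := lower_central_rec n.-1.

Lemma lower_central_subgroup n : is_subgroup (lower_central n).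
Proof.
by rewrite /lower_central; case: n.-1 => [|m] //=; exact: subgroup_gen_subgroup.
Qed.

Definition in_lower_central n : {pred G} := fun x => x \in lower_central n.

Lemma lower_central_closed n : group_closed (in_lower_central n).
Proof.
have [H1 HV] := lower_central_subgroup n.
split=> [|x y]; first by apply/mem_set.
by move=> /set_mem Hx /set_mem Hy; apply/mem_set/HV.
Qed.

End Subgroups.

(* gamma_n(G) as a group in its own right.                                    *)
Record gamma (G : groupType) (n : nat) : Type := Gamma {
  gamma_val : G;
  gamma_valP : in_lower_central n gamma_val
}.

HB.instance Definition _ (G : groupType) n := [isSub for @gamma_val G n].
HB.instance Definition _ (G : groupType) n := [Choice of gamma G n by <:].
HB.instance Definition _ (G : groupType) n :=
  SubChoice_isSubGroup.Build G _ (gamma G n) (@lower_central_closed G n).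

Definition kernel (G H : groupType) (f : {hom G -> H}) : set G :=
  [set x | f x = 1].

(* The letter (b, x) stands for x if b is false and for x^-1 if b is true.    *)
Definition word (X : Type) := seq (bool * X).
HB.instance Definition _ (X : choiceType) :=
  Choice.copy (word X) (seq (bool * X)).

Definition letter (X : Type) (x : X) : word X := [:: (false, x)].
Definition word_inv (X : Type) (w : word X) : word X :=
  rev [seq (~~ p.1, p.2) | p <- w].

Section Presentation.
Variables (X : choiceType) (R : set (word X * word X)).

(* A pair (l, r) in R is the relation l = r.                                  *)
Inductive word_equiv : word X -> word X -> Prop :=
| WordRefl u : word_equiv u u
| WordSym u v : word_equiv u v -> word_equiv v u
| WordTrans u v w : word_equiv u v -> word_equiv v w -> word_equiv u w
| WordCat u u' v v' : word_equiv u u' -> word_equiv v v' ->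
    word_equiv (u ++ v) (u' ++ v')
| WordCancel b x : word_equiv [:: (b, x); (~~ b, x)] [::]
| WordRel l r : R (l, r) -> word_equiv l r.

Definition word_equivb (u v : word X) : bool := `[< word_equiv u v >].

Lemma word_equivb_refl : reflexive word_equivb.
Proof. by move=> u; apply/asboolP; constructor. Qed.
Lemma word_equivb_sym : symmetric word_equivb.
Proof. by move=> u v; apply/asboolP/asboolP; apply: WordSym. Qed.
Lemma word_equivb_trans : transitive word_equivb.
Proof.
move=> v u w /asboolP uv /asboolP vw; apply/asboolP; exact: WordTrans uv vw.
Qed.

Canonical word_equiv_rel :=
  EquivRel word_equivb word_equivb_refl word_equivb_sym word_equivb_trans.

(* The group < X | R >.                                                       *)
Definition presented : Type := {eq_quot word_equiv_rel}.
HB.instance Definition _ := Choice.copy presented {eq_quot word_equiv_rel}.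
HB.instance Definition _ := EqQuotient.copy presented {eq_quot word_equiv_rel}.

Definition word_class (w : word X) : presented := \pi_presented w.

Lemma word_classP u v : word_class u = word_class v <-> word_equiv u v.
Proof.
split=> [/eqP|uv]; first by rewrite piE => /asboolP.
by apply/eqP; rewrite piE; apply/asboolP.
Qed.

Lemma word_equiv_repr u : word_equiv (repr (word_class u)) u.
Proof. by apply/word_classP; rewrite /word_class reprK. Qed.

Lemma word_invK : involutive (@word_inv X).
Proof.
move=> w; rewrite /word_inv map_rev revK -map_comp (eq_map (g := id)) ?map_id //.
by move=> [b y] /=; rewrite negbK.
Qed.

Lemma word_mulVw w : word_equiv (word_inv w ++ w) [::].
Proof.
elim: w => [|[b x] w IH]; first exact: WordRefl.
rewrite /word_inv /= rev_cons -cats1 -catA /=.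
apply: WordTrans IH; apply: WordCat (WordRefl _) _.
rewrite -[X in word_equiv _ X]cat0s.
apply: (@WordCat [:: (~~ b, x); (b, x)]) (WordRefl _).
rewrite -{2}[b]negbK; exact: WordCancel.
Qed.

Lemma word_mulwV w : word_equiv (w ++ word_inv w) [::].
Proof. by rewrite -{1}[w]word_invK; apply: word_mulVw. Qed.

Lemma word_equiv_inv u v :
  word_equiv u v -> word_equiv (word_inv u) (word_inv v).
Proof.
move=> uv; apply: (@WordTrans _ (word_inv u ++ (v ++ word_inv v))).
  rewrite -[X in word_equiv X _]cats0; apply: WordCat (WordRefl _) _.
  exact/WordSym/word_mulwV.
rewrite catA -[X in word_equiv _ X]cat0s; apply: WordCat (WordRefl _).
apply: WordTrans (word_mulVw u); apply: WordCat (WordRefl _) _; exact: WordSym.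
Qed.

Definition pres_mul (a b : presented) : presented :=
  word_class (repr a ++ repr b).
Definition pres_inv (a : presented) : presented :=
  word_class (word_inv (repr a)).
Definition pres_one : presented := word_class [::].

Lemma pres_mulE u v :
  pres_mul (word_class u) (word_class v) = word_class (u ++ v).
Proof. by apply/word_classP; apply: WordCat; apply: word_equiv_repr. Qed.
Lemma pres_invE u : pres_inv (word_class u) = word_class (word_inv u).
Proof. by apply/word_classP; apply/word_equiv_inv/word_equiv_repr. Qed.

Lemma presW (P : presented -> Prop) :
  (forall w, P (word_class w)) -> forall a, P a.
Proof. by move=> H a; rewrite -[a]reprK; apply: H. Qed.

Lemma pres_mulA : associative pres_mul.
Proof.
by elim/presW=> u; elim/presW=> v; elim/presW=> w; rewrite !pres_mulE catA.
Qed.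
Lemma pres_mul1g : left_id pres_one pres_mul.
Proof. by elim/presW=> u; rewrite pres_mulE. Qed.
Lemma pres_mulg1 : right_id pres_one pres_mul.
Proof. by elim/presW=> u; rewrite pres_mulE cats0. Qed.
Lemma pres_mulVg : left_inverse pres_one pres_inv pres_mul.
Proof.
by elim/presW=> u; rewrite pres_invE pres_mulE; apply/word_classP/word_mulVw.
Qed.
Lemma pres_mulgV : right_inverse pres_one pres_inv pres_mul.
Proof.
by elim/presW=> u; rewrite pres_invE pres_mulE; apply/word_classP/word_mulwV.
Qed.

HB.instance Definition _ := isGroup.Build presented
  pres_mulA pres_mul1g pres_mulg1 pres_mulVg pres_mulgV.

Lemma word_class_cat u v : word_class (u ++ v) = word_class u * word_class v.
Proof. by rewrite -[RHS]/(pres_mul _ _) pres_mulE. Qed.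
Lemma word_class_inv u : word_class (word_inv u) = (word_class u)^-1.
Proof. by rewrite -[RHS]/(pres_inv _) pres_invE. Qed.
Lemma word_class_rel l r : R (l, r) -> word_class l = word_class r.
Proof. by move=> Rlr; apply/word_classP/WordRel. Qed.

Definition pres_gen (x : X) : presented := word_class (letter x).

Lemma pres_ind (P : presented -> Prop) :
    P 1 -> (forall x a, P a -> P (pres_gen x * a)) ->
    (forall x a, P a -> P ((pres_gen x)^-1 * a)) ->
  forall a, P a.
Proof.
move=> P1 PM PV; elim/presW; elim=> [|[b x] w IH]; first exact: P1.
rewrite -cat1s word_class_cat; case: b; last exact: PM.
by rewrite -[[:: _]]/(word_inv (letter x)) word_class_inv; apply: PV.
Qed.

Section Lift.
Variables (K : groupType) (f : X -> K).

Definition word_eval (w : word X) : K :=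
  foldr (fun p k => (if p.1 then (f p.2)^-1 else f p.2) * k) 1 w.

Lemma word_eval_cat u v : word_eval (u ++ v) = word_eval u * word_eval v.
Proof. by elim: u => [|p u IH] /=; rewrite ?mul1g // IH mulgA. Qed.

Definition respects : Prop := forall l r, R (l, r) -> word_eval l = word_eval r.

Hypothesis fR : respects.

Lemma word_eval_equiv u v : word_equiv u v -> word_eval u = word_eval v.
Proof.
elim=> // [u1 v1 w1 _ -> _ -> //|u1 u2 v1 v2 _ e1 _ e2|b x].
- by rewrite !word_eval_cat e1 e2.
- by case: b; rewrite /= mulg1 (mulVg, mulgV).
Qed.

Definition pres_lift_fun of respects := fun a : presented => word_eval (repr a).
Local Notation lift := (pres_lift_fun fR).

Lemma pres_lift_class w : lift (word_class w) = word_eval w.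
Proof. exact/word_eval_equiv/word_equiv_repr. Qed.

Lemma pres_lift_subproof : monoid_morphism lift.
Proof.
split; first by rewrite [LHS](pres_lift_class [::]).
elim/presW=> u; elim/presW=> v.
by rewrite -word_class_cat !pres_lift_class word_eval_cat.
Qed.
HB.instance Definition _ :=
  isUMagmaMorphism.Build presented K lift pres_lift_subproof.

Definition pres_lift : {hom presented -> K} := lift.

Lemma pres_lift_gen x : pres_lift (pres_gen x) = f x.
Proof. by rewrite [LHS]pres_lift_class /= mulg1. Qed.

End Lift.

Lemma pres_hom_ext (K : groupType) (f g : {hom presented -> K}) :
  (forall x, f (pres_gen x) = g (pres_gen x)) -> f =1 g.
Proof.
move=> fg; apply: pres_ind => [|x a e|x a e]; first by rewrite !gmulf1.
  by rewrite !gmulfM fg e.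
by rewrite !gmulfM !gmulfV fg e.
Qed.

End Presentation.

Definition finitely_presented (G : groupType) : Prop :=
  exists (m : nat) (R : seq (word 'I_m * word 'I_m))
         (f : {hom presented [set` R] -> G}), bijective f.

(* A right action of G on K by automorphisms.                                 *)
Record gaction (G K : groupType) := GAction {
  act :> K -> G -> K;
  act1 : forall k, act k 1 = k;
  actM : forall k g h, act k (g * h) = act (act k g) h;
  act_morph : forall g, {morph act^~ g : k l / k * l}
}.

(* G and H act on each other, and each on itself by conjugation.              *)
Record compatible_actions (G H : groupType) := CompatibleActions {
  actl : gaction H G;
  actr : gaction G H;
  compatl : forall (g g1 : G) (h : H),
    actl g (actr h g1) = actl (g ^ g1^-1) h ^ g1;
  compatr : forall (h h1 : H) (g : G),
    actr h (actl g h1) = actr (h ^ h1^-1) g ^ h1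
}.

Section Tensor.
Variables (G H : groupType) (A : compatible_actions G H).
Local Notation "g '^^' h" := (actl A g h) (at level 30).
Local Notation "h '^_' g" := (actr A h g) (at level 30).

Inductive tensor_rel : set (word (G * H) * word (G * H)) :=
| TensorRelL g g1 h :
    tensor_rel (letter (g * g1, h), letter (g ^ g1, h ^_ g1) ++ letter (g1, h))
| TensorRelR g h h1 :
    tensor_rel (letter (g, h * h1), letter (g, h1) ++ letter (g ^^ h1, h ^ h1)).

(* The non-abelian tensor product of G and H, and the generators g (x) h.     *)
Definition tensor : Type := presented tensor_rel.
HB.instance Definition _ := Group.on tensor.

Definition tens (g : G) (h : H) : tensor := pres_gen tensor_rel (g, h).

Lemma tensMl g g1 h : tens (g * g1) h = tens (g ^ g1) (h ^_ g1) * tens g1 h.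
Proof. by rewrite -[RHS]word_class_cat; apply/word_class_rel/TensorRelL. Qed.
Lemma tensMr g h h1 : tens g (h * h1) = tens g h1 * tens (g ^^ h1) (h ^ h1).
Proof. by rewrite -[RHS]word_class_cat; apply/word_class_rel/TensorRelR. Qed.

Section Lift.
Variables (K : groupType) (f : G -> H -> K).
Hypothesis fl : forall g g1 h, f (g * g1) h = f (g ^ g1) (h ^_ g1) * f g1 h.
Hypothesis fr : forall g h h1, f g (h * h1) = f g h1 * f (g ^^ h1) (h ^ h1).

Lemma tens_respects : respects tensor_rel (fun p => f p.1 p.2).
Proof.
suff E p : tensor_rel p -> word_eval (fun p => f p.1 p.2) p.1 =
    word_eval (fun p => f p.1 p.2) p.2 by move=> l r /E.
by case=> *; rewrite /= !mulg1.
Qed.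

Definition tens_lift : {hom tensor -> K} := pres_lift tens_respects.

Lemma tens_liftE g h : tens_lift (tens g h) = f g h.
Proof. exact: (pres_lift_gen tens_respects (g, h)). Qed.

End Lift.
End Tensor.

Section ActionTheory.
Variables (G K : groupType) (a : gaction G K).

Lemma act1g g : a 1 g = 1.
Proof. by apply: (mulgI (a 1 g)); rewrite -act_morph !mulg1. Qed.
Lemma actV k g : a k^-1 g = (a k g)^-1.
Proof. by apply: (mulgI (a k g)); rewrite -act_morph !mulgV act1g. Qed.
Lemma actJ k l g : a (k ^ l) g = a k g ^ a l g.
Proof. by rewrite /conjg !act_morph actV. Qed.
Lemma actK g k : a (a k g) g^-1 = k.
Proof. by rewrite -actM mulgV act1. Qed.
Lemma actKV g k : a (a k g^-1) g = k.
Proof. by rewrite -actM mulVg act1. Qed.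

End ActionTheory.

Definition conj_action (G : groupType) : gaction G G :=
  @GAction G G (@conjg G) (@conjg1 G) (@conjgM G) (fun g k l => conjMg k l g).

(* The tensor powers are built together with the data used in their           *)
(* definition: an action of G on T and the homomorphism lambda : T -> G,      *)
(* through which T acts on G.  The two identities (those of a crossed module) *)
(* make the actions compatible.                                               *)
Record xmod (G : groupType) := XMod {
  xm_car : groupType;
  xm_act : gaction G xm_car;
  xm_lambda : {hom xm_car -> G};
  xm_equiv : forall t g, xm_lambda (xm_act t g) = xm_lambda t ^ g;
  xm_peiffer : forall t u, xm_act t (xm_lambda u) = t ^ u
}.

Section NextPower.
Variables (G : groupType) (M : xmod G).
Local Notation T := (xm_car M).
Local Notation a := (xm_act M).
Local Notation lam := (xm_lambda M).

(* g ^ t = g ^ lambda(t).                                                     *)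
Definition lambda_act (g : G) (t : T) : G := g ^ lam t.
Lemma lambda_act1 g : lambda_act g 1 = g.
Proof. by rewrite /lambda_act gmulf1 conjg1. Qed.
Lemma lambda_actM g t u : lambda_act g (t * u) = lambda_act (lambda_act g t) u.
Proof. by rewrite /lambda_act gmulfM conjgM. Qed.
Lemma lambda_act_morph t : {morph lambda_act^~ t : g h / g * h}.
Proof. by move=> g h; rewrite /lambda_act conjMg. Qed.
Definition lambda_action : gaction T G :=
  GAction lambda_act1 lambda_actM lambda_act_morph.

Lemma xm_compatl (t u : T) (g : G) :
  a t (lambda_action g u) = a (t ^ u^-1) g ^ u.
Proof.
rewrite /= /lambda_act -2!xm_peiffer gmulfV -!actM.
by rewrite /conjg !mulgA.
Qed.
Lemma xm_compatr (g g1 : G) (t : T) :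
  lambda_action g (a t g1) = lambda_action (g ^ g1^-1) t ^ g1.
Proof.
by rewrite /= /lambda_act xm_equiv -!conjgM /conjg !(invgM, mulgA).
Qed.

Definition xm_compatible : compatible_actions T G :=
  CompatibleActions xm_compatl xm_compatr.

Local Notation TG := (tensor xm_compatible).
Local Notation "t ** g" := (tens xm_compatible t g) (at level 40).

Lemma diag_fl x (t t1 : T) (g : G) :
  a (t * t1) x ** (g ^ x) =
  (a (t ^ t1) x ** (lambda_action g t1 ^ x)) * (a t1 x ** (g ^ x)).
Proof.
rewrite act_morph tensMl; congr ((_ ** _) * _); first by rewrite actJ.
by rewrite /= /lambda_act xm_equiv -conjJg.
Qed.
Lemma diag_fr x (t : T) (g g1 : G) :
  a t x ** ((g * g1) ^ x) =
  (a t x ** (g1 ^ x)) * (a (a t g1) x ** ((g ^ g1) ^ x)).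
Proof.
rewrite conjMg tensMr; congr (_ * (_ ** _)); last by rewrite -conjJg.
by rewrite /= -!actM; congr (a t _); rewrite /conjg !mulgA mulgV mul1g.
Qed.

(* (t (x) g) ^ x = t ^ x (x) g ^ x.                                           *)
Definition diag_hom (x : G) : {hom TG -> TG} :=
  tens_lift (A := xm_compatible) (f := fun t g => a t x ** (g ^ x))
    (diag_fl x) (diag_fr x).
Definition diag_act (z : TG) (x : G) : TG := diag_hom x z.

Lemma diag_actE t g x : diag_act (t ** g) x = a t x ** (g ^ x).
Proof. exact: tens_liftE. Qed.
Lemma diag_act_morph x : {morph diag_act^~ x : z w / z * w}.
Proof. by move=> z w; rewrite /diag_act gmulfM. Qed.
Lemma diag_act1 z : diag_act z 1 = z.
Proof.
apply: (pres_hom_ext (f := diag_hom 1) (g := idfun)) => -[t g].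
by rewrite [LHS]diag_actE act1 conjg1.
Qed.
Lemma diag_actM z x y : diag_act z (x * y) = diag_act (diag_act z x) y.
Proof.
apply: (pres_hom_ext (f := diag_hom (x * y)) (g := diag_hom y \o diag_hom x)).
move=> -[t g]; rewrite [LHS]diag_actE actM conjgM /=.
by rewrite -[RHS]/(diag_act (diag_act (t ** g) x) y) !diag_actE.
Qed.
Definition diag_action : gaction G TG :=
  GAction diag_act1 diag_actM diag_act_morph.

Lemma next_lambda_fl (t t1 : T) (g : G) :
  [~ lam (t * t1), g] = [~ lam (t ^ t1), lambda_action g t1] * [~ lam t1, g].
Proof.
rewrite /= /lambda_act gmulfM gmulfJ -conjRg /commg /conjg.
by rewrite ?(invgM, mulgA, mulgK, mulgVK).
Qed.
Lemma next_lambda_fr (t : T) (g g1 : G) :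
  [~ lam t, g * g1] = [~ lam t, g1] * [~ lam (a t g1), g ^ g1].
Proof.
rewrite xm_equiv -conjRg /commg /conjg.
by rewrite ?(invgM, mulgA, mulgK, mulgVK).
Qed.

(* lambda (t (x) g) = [lambda t, g].                                          *)
Definition next_lambda : {hom TG -> G} :=
  tens_lift (A := xm_compatible) (f := fun t g => [~ lam t, g])
    next_lambda_fl next_lambda_fr.

Lemma next_lambdaE t g : next_lambda (t ** g) = [~ lam t, g].
Proof. exact: tens_liftE. Qed.

Lemma next_equiv z x : next_lambda (diag_action z x) = next_lambda z ^ x.
Proof.
elim/pres_ind: z => [|[t g] z IH|[t g] z IH].
- by rewrite act1g gmulf1 conj1g.
- rewrite act_morph !gmulfM IH conjMg; congr (_ * _).
  by rewrite [diag_action _ x]diag_actE !next_lambdaE xm_equiv conjRg.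
- rewrite act_morph actV !gmulfM !gmulfV IH conjMg conjVg; congr (_^-1 * _).
  by rewrite [diag_action _ x]diag_actE !next_lambdaE xm_equiv conjRg.
Qed.

Lemma tens_conj (t s : T) (g h : G) :
  diag_act (t ** g) [~ lam s, h] = (t ** g) ^ (s ** h).
Proof.
suff E (t' : T) (g' : G) : diag_act (t' ** g') (h * lam s) * (s ** h) =
    (s ** h) * diag_act (t' ** g') (lam s * h).
  have := E (a t (h * lam s)^-1) (g ^ (h * lam s)^-1).
  rewrite -diag_actE -!diag_actM mulVg diag_act1 => {}E.
  rewrite [in RHS]/conjg E mulKg; congr (diag_act _ _).
  by rewrite /commg /conjg invgM !mulgA.
have E1 := tensMl xm_compatible t' s (g' * h).
have E2 := tensMr xm_compatible (t' * s) g' h.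
move: E1; rewrite {}E2 tensMl [actl _ _ _]act_morph tensMl.
rewrite -[actr xm_compatible (g' * h) s]/(lambda_act (g' * h) s).
rewrite lambda_act_morph tensMr (tensMr _ s) -!mulgA => /mulgI.
rewrite !mulgA => /mulIg /esym; rewrite !diag_actE /= /lambda_act.
rewrite -(xm_peiffer t' s) -(xm_peiffer _ (a s h)) xm_equiv -!actM -!conjgM.
have -> : lam s * h ^ lam s = h * lam s by rewrite /conjg !mulgA mulgV mul1g.
by have -> : h * lam s ^ h = lam s * h by rewrite /conjg !mulgA mulgV mul1g.
Qed.

Lemma next_peiffer z w : diag_action z (next_lambda w) = z ^ w.
Proof.
have gen s h u : diag_action u (next_lambda (s ** h)) = u ^ (s ** h).
  rewrite next_lambdaE; elim/pres_ind: u => [|[t g] u IH|[t g] u IH].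
  - by rewrite act1g conj1g.
  - by rewrite act_morph conjMg IH; congr (_ * _); apply: tens_conj.
  - rewrite act_morph actV conjMg conjVg IH; congr (_^-1 * _).
    exact: tens_conj.
elim/pres_ind: w z => [|[s h] w IH|[s h] w IH] z.
- by rewrite gmulf1 act1 conjg1.
- by rewrite gmulfM actM IH conjgM; congr (_ ^ _); apply: gen.
- rewrite gmulfM gmulfV actM IH conjgM; congr (_ ^ _).
  by rewrite -[z in LHS](conjgKV (s ** h)) -(gen s h) actK.
Qed.

Definition next_power : xmod G := XMod next_equiv next_peiffer.

End NextPower.

Section TensorPowers.
Variable G : groupType.

Definition base_power : xmod G :=
  @XMod G G (conj_action G) idfun (fun _ _ => erefl) (fun _ _ => erefl).

Fixpoint tensor_power_rec (n : nat) : xmod G :=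
  if n is m.+1 then next_power (tensor_power_rec m) else base_power.

(* The n-fold tensor product for n >= 2.  As [base_power] is G acting on      *)
(* itself by conjugation, the case n = 2 is G (x) G; the 1-fold product is G, *)
(* and the index 0 is junk.                                                   *)
Definition tensor_power_xmod (n : nat) : xmod G := tensor_power_rec n.-1.
Definition tensor_power (n : nat) : groupType := xm_car (tensor_power_xmod n).

Lemma lambda_in_lower_central n (t : tensor_power n) :
  in_lower_central n (xm_lambda (tensor_power_xmod n) t).
Proof.
apply/mem_set; move: t; rewrite /tensor_power /tensor_power_xmod /lower_central.
elim: n.-1 => [|m IH] t //=.
have SG := @subgroup_gen_subgroup G
  [set [~ x, y] | x in lower_central_rec m & y in [set: G]].
have genP s g : lower_central_rec m.+1
    (next_lambda (tensor_power_rec m) (tens _ s g)).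
  rewrite next_lambdaE; apply: sub_gen_smallest.
  by exists (xm_lambda (tensor_power_rec m) s); [apply: IH | exists g].
elim/pres_ind: t => [|[s g] t IHt|[s g] t IHt].
- by rewrite gmulf1; case: SG.
- by rewrite gmulfM; apply: (subgroupM SG) => //; apply: genP.
- rewrite gmulfM gmulfV; apply: (subgroupM SG) => //; apply: (subgroupV SG).
  exact: genP.
Qed.

Definition lambda_fun n (t : tensor_power n) : gamma G n :=
  Gamma (lambda_in_lower_central t).

Lemma lambda_subproof n : monoid_morphism (@lambda_fun n).
Proof. by split=> [|s t]; apply: val_inj; rewrite /= (gmulf1, gmulfM). Qed.
HB.instance Definition _ n :=
  isUMagmaMorphism.Build (tensor_power n) (gamma G n) (@lambda_fun n)
    (@lambda_subproof n).

Definition lambda (n : nat) : {hom tensor_power n -> gamma G n} := @lambda_fun n.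

(* ((g_0 (x) g_1) (x) ... ) (x) g_n and [g_0, g_1, ..., g_n].                 *)
Fixpoint pure_tensor (g : nat -> G) (n : nat) : xm_car (tensor_power_rec n) :=
  if n is m.+1 then tens _ (pure_tensor g m) (g m.+1) else g 0%N.
Fixpoint long_commg (g : nat -> G) (n : nat) : G :=
  if n is m.+1 then [~ long_commg g m, g m.+1] else g 0%N.

Lemma lambda_pure g n :
  val (lambda n.+1 (pure_tensor g n)) = long_commg g n.
Proof.
by elim: n => [//|n IH] /=; rewrite next_lambdaE -IH.
Qed.

Lemma act_pure g n x :
  xm_act (tensor_power_rec n) (pure_tensor g n) x =
  pure_tensor (fun i => g i ^ x) n.
Proof. by elim: n => [//|n IH] /=; rewrite diag_actE IH. Qed.

End TensorPowers.

(* Main.v *)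
Require Import Defs.
From HB Require Import structures.
From mathcomp Require Import all_boot.
From mathcomp Require Import boolp classical_sets.

(* Write T_n for the n-fold tensor product, a crossed module lambda : T_n -> G *)
(* with image gamma_n(G) and hence central kernel K_n.                         *)
(* (1) If G is finitely generated then so is T_n as a group with operators G.  *)
(* (2) K_n is finitely generated as a group with operators G, for any crossed  *)
(* module T -> G with this finiteness whose image contains some gamma_k(G).    *)
(* Pull T back to a free group F of finite rank over G; the pullback is still  *)
(* F-finitely generated as G is finitely presented, and it is a central        *)
(* extension of a subgroup S of F, so it splits: (t, f) |-> t / sigma f is a   *)
(* retraction onto K.  This retraction extends to an F-equivariant map from    *)
(* the pullback to the module of functions F -> K which is injective on K.     *)
(* Its image is a finitely generated module over the nilpotent group           *)
(* F / gamma_k(F), hence Noetherian by Hall's theorem, so that its submodule K *)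
(* is finitely generated.                                                      *)
(* (3) The G-action can be dropped by induction on n: with mu : t (x) g |->    *)
(* t^-1 * t^g one has z^-1 * z^g = mu z (x) g, so K_(n+1) is generated by its  *)
(* module generators and the j (x) g with j in K_n, and the latter generate a  *)
(* finitely generated group because K_n is one.                                *)

Set Implicit Arguments.
Unset Strict Implicit.
Unset Printing Implicit Defensive.

Local Open Scope classical_set_scope.
Local Open Scope group_scope.

(** By the Peiffer identity the kernel of a crossed module is central ([xmod_kernel_central]), so
    its finite generation over G is a question about modules. Three facts carry the proof. Hall's
    theorem, [nilpotent_noetherian], comes from a twisted form of Hilbert's basis theorem,
    [laurent_noetherian], applied along the lower central series. The lift [free_section], built by
    Reidemeister-Schreier rewriting, embeds the kernel into a Noetherian module, whence
    [xmod_kernel_op_generated]. The identity [tens_commutator_map] measures the action of G on the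
    next tensor power by tensors whose left factor is a value of [mu]; on the kernel these values
    lie in the previous kernel, which removes the operators in [next_power_kernel_fg]. The induction
    [tensor_power_rec_fg] carries operator generation of the tensor power together with finite
    generation of the kernel. *)

Lemma is_subgroupI (G : groupType) (L : set G) :
  L 1 -> (forall x y, L x -> L y -> L (x * y)) -> (forall x, L x -> L x^-1) ->
  is_subgroup L.
Proof. by move=> L1 LM LV; split=> // x y Lx Ly; apply: LM => //; apply: LV. Qed.

Lemma subgroup_genS (G : groupType) (S L : set G) :
  is_subgroup L -> S `<=` L -> subgroup_gen S `<=` L.
Proof. by move=> sgL SL; apply: smallest_sub. Qed.

Lemma sub_subgroup_gen (G : groupType) (S : set G) : S `<=` subgroup_gen S.
Proof. exact: sub_gen_smallest. Qed.

Lemma subgroupX (G : groupType) (L : set G) x n :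
  is_subgroup L -> L x -> L (x ^+ n).
Proof.
move=> sgL Lx; elim: n => [|n IH]; first exact: sgL.1.
by rewrite expgS; apply: subgroupM.
Qed.

Lemma subgroup_gen_ind (G : groupType) (S : set G) (P : G -> Prop) :
  (forall x, S x -> P x) -> P 1 -> (forall x y, P x -> P y -> P (x * y)) ->
  (forall x, P x -> P x^-1) -> forall x, subgroup_gen S x -> P x.
Proof.
move=> PS P1 PM PV x.
by apply: (@subgroup_genS _ _ [set x | P x]) => //; apply: is_subgroupI.
Qed.

Lemma group_ind_gen (G : groupType) (S : set G) (P : G -> Prop) :
  subgroup_gen S = [set: G] ->
  (forall x, S x -> P x) -> P 1 -> (forall x y, P x -> P y -> P (x * y)) ->
  (forall x, P x -> P x^-1) -> forall x, P x.
Proof.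
by move=> genS PS P1 PM PV x; apply: (subgroup_gen_ind PS P1 PM PV); rewrite genS.
Qed.

(** * Groups with operators and the Noetherian condition *)

Section InvariantSubgroups.
Variables (F A : groupType) (a : gaction F A).
Implicit Types (H : set F) (L M : set A).

Definition inv_subgroup H L : Prop :=
  is_subgroup L /\ forall h x, H h -> L x -> L (a x h).

(** For invariant L this says that L is the smallest invariant subgroup containing s; stated by
    minimality, each use is an induction over a chosen invariant subgroup. *)
Definition op_generated H L (s : seq A) : Prop :=
  [set` s] `<=` L /\
  forall L', inv_subgroup H L' -> [set` s] `<=` L' -> L `<=` L'.

Definition noetherian H M : Prop :=
  forall L, inv_subgroup H L -> L `<=` M -> exists s, op_generated H L s.

Lemma inv_subgroupI H L M :
  inv_subgroup H L -> inv_subgroup H M -> inv_subgroup H (L `&` M).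
Proof.
move=> [sL iL] [sM iM]; split; last by move=> h x Hh [Lx Mx]; split; auto.
split; first by split; [apply: sL.1|apply: sM.1].
by move=> x y [Lx Mx] [Ly My]; split; [apply: sL.2|apply: sM.2].
Qed.

Hypothesis AC : commutative (@mul A).

Lemma mulgACA_comm : interchange (@mul A) (@mul A).
Proof. by move=> x y z t; rewrite -!mulgA (mulgA y z t) (AC y z) !mulgA. Qed.

Lemma divgACA_comm x y z t : (x * y) / (z * t) = (x / z) * (y / t) :> A.
Proof. by rewrite invgM (AC t^-1) mulgACA_comm. Qed.

Section CyclicModule.
Variables (H : set F) (M : set A) (b : A).
Hypotheses (iM : inv_subgroup H M) (noethM : noetherian H M).
Hypothesis trivb : forall h, H h -> a b h = b.

(** In additive terms this is M + Zb; a quotient of two natural powers stands for an integer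
    multiple of b. *)
Definition adjoin_gen : set A :=
  [set u | exists v n m, M v /\ u = v * (b ^+ n / b ^+ m)].

Let tri h n : H h -> a (b ^+ n) h = b ^+ n.
Proof.
by move=> Hh; elim: n => [|n IH]; rewrite ?act1g // expgS act_morph IH trivb.
Qed.

Lemma adjoin_gen_inv : inv_subgroup H adjoin_gen.
Proof.
split; last first.
  move=> h _ Hh [v [n [m [Mv ->]]]]; exists (a v h), n, m.
  by split; [exact: iM.2|rewrite !act_morph actV !tri].
split.
  by exists 1, 0%N, 0%N; split; [exact: iM.1.1|rewrite mulgV mulg1].
move=> _ _ [v [n [m [Mv ->]]]] [v' [n' [m' [Mv' ->]]]].
exists (v / v'), (n + m')%N, (m + n')%N; split; first exact: iM.1.2.
rewrite divgACA_comm; congr (_ * _).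
by rewrite invgF mulgACA_comm !expgnDr invgM [_^-1 * _^-1]AC.
Qed.

Lemma sub_adjoin_gen : M `<=` adjoin_gen.
Proof. by move=> v Mv; exists v, 0%N, 0%N; rewrite mulgV mulg1. Qed.

Lemma adjoin_gen_mem : adjoin_gen b.
Proof. by exists 1, 1%N, 0%N; split; [exact: iM.1.1|rewrite divg1 mul1g]. Qed.

(** An extension of M by a cyclic group: L is generated by generators of its intersection with M and
    one element whose b-exponent is the least positive one occurring in L. *)
Lemma adjoin_gen_noetherian : noetherian H adjoin_gen.
Proof.
move=> L iL LM; have [sgL _] := iL; have [sgM _] := iM.
(* Up to inversion, the exponent of b may be taken to be a natural number. *)
have posb u : L u -> exists v n, M v /\ (u = v * b ^+ n \/ u^-1 = v * b ^+ n).
  move=> /LM [v [n [m [Mv ->]]]]; have [le_mn|lt_nm] := leqP m n.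
    by exists v, (n - m)%N; split; [|left; rewrite expgnFr].
  exists v^-1, (m - n)%N; split; first exact: subgroupV.
  by right; rewrite (expgnFr _ (ltnW lt_nm)) invgM invgF AC.
have [s0 [s0L s0gen]] : exists s, op_generated H (L `&` M) s.
  by apply: noethM => [|x []//]; apply: inv_subgroupI.
have [[d0 [d0_gt0 d0P]]|noI] :=
    pselect (exists d, 0 < d /\ exists2 v, M v & L (v * b ^+ d)); last first.
  exists s0; split=> [x /s0L []//|L' iL' s0L' u Lu]; apply: (s0gen L') => //.
  split=> //; have [v [[|n] [Mv [e|e]]]] := posb u Lu.
  - by rewrite e mulg1.
  - by rewrite -[u]invgK e mulg1; apply: subgroupV.
  - by case: noI; exists n.+1; split=> //; exists v; rewrite -?e.
  - case: noI; exists n.+1; split=> //; exists v; rewrite -?e //.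
    exact: subgroupV.
have exd : exists d, `[< 0 < d /\ exists2 v, M v & L (v * b ^+ d) >].
  by exists d0; apply/asboolP.
case: (ex_minnP exd) => d /asboolP [d_gt0 [v0 Mv0 Lv0]] dmin.
exists (v0 * b ^+ d :: s0); split=> [x /=|L' iL' sL' u Lu].
  by rewrite inE => /orP [/eqP -> //|/s0L []].
have L0L' : L `&` M `<=` L'.
  by apply: s0gen => // x sx; apply: sL'; rewrite /= inE sx orbT.
have wL' : L' (v0 * b ^+ d) by apply: sL'; rewrite /= inE eqxx.
(* Euclidean division of n by d: the remainder occurs as an exponent in L, so it vanishes by
   minimality of d. *)
have key u' v n : L u' -> M v -> u' = v * b ^+ n -> L' u'.
  move=> Lu' Mv e; pose q := n %/ d; pose w := (v0 * b ^+ d) ^+ q.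
  have Lw : L w by apply: subgroupX.
  have L'w : L' w by apply: subgroupX => //; case: iL'.
  have ew : u' / w = v / v0 ^+ q * b ^+ (n %% d).
    rewrite e /w (expgMn _ (AC _ _)) divgACA_comm; congr (_ * _).
    by rewrite {1}(divn_eq n d) AC mulnC expgnDr expgnA mulKg.
  have Mv' : M (v / v0 ^+ q) by apply: sgM.2 => //; apply: subgroupX.
  have Luw : L (u' / w) by apply: sgL.2.
  rewrite -[u'](mulgVK w); apply: subgroupM => //; first by case: iL'.
  apply: L0L'; split=> //; rewrite ew.
  suff -> : n %% d = 0%N by rewrite mulg1.
  apply/eqP; rewrite -leqn0 leqNgt; apply/negP => r_gt0.
  suff /dmin : `[< 0 < n %% d /\ exists2 v, M v & L (v * b ^+ (n %% d)) >].
    by rewrite leqNgt ltn_mod d_gt0.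
  by apply/asboolP; split=> //; exists (v / v0 ^+ q); rewrite -?ew.
have [v [n [Mv [e|e]]]] := posb u Lu; first exact: key e.
rewrite -[u]invgK; apply: subgroupV; first by case: iL'.
by apply: key e => //; apply: subgroupV.
Qed.

End CyclicModule.

(** * Hall's basis theorem *)

Section CyclicExtension.
Variables (H H' : set F) (M0 : set A) (c : F).
Hypotheses (sgH : is_subgroup H) (sgH' : is_subgroup H').
Hypotheses (HH' : H `<=` H') (H'c : H' c).
Hypothesis H'gen : H' `<=` subgroup_gen (c |` H).
Hypothesis normH : forall h, H h -> H (h ^ c) /\ H (h ^ c^-1).
Hypotheses (iM0 : inv_subgroup H M0) (noethM0 : noetherian H M0).

Let normHX h n : H h -> H (h ^ (c ^+ n)) /\ H (h ^ (c ^- n)).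
Proof.
move=> Hh; elim: n => [|n [IH1 IH2]]; first by rewrite invg1 conjg1.
rewrite {1}expgSr expgS invgM !conjgM.
by split; [case: (normH IH1)|case: (normH IH2)].
Qed.

(* The products of x_i ^ (c ^+ i) over i < n with x_i in M0, that is, the      *)
(* polynomials in c of degree < n.                                            *)
Fixpoint poly_set (n : nat) : set A :=
  if n is m.+1 then
    [set u | exists v x, [/\ poly_set m v, M0 x & u = v * a x (c ^+ m)]]
  else [set 1].

(** Laurent polynomials in c with coefficients in M0: a power of c clears the denominators. *)
Definition laurent_set : set A := [set u | exists k n, poly_set n (a u (c ^+ k))].

Let polyS n : poly_set n `<=` poly_set n.+1.
Proof. by move=> u Pu; exists u, 1; rewrite act1g mulg1; split=> //; case: iM0 => -[]. Qed.

Let poly_le m n : m <= n -> poly_set m `<=` poly_set n.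
Proof.
move=> /subnK <-; elim: (n - m) => [//|k IH] u Pu.
by rewrite addSn; apply: polyS; apply: IH.
Qed.

Let poly_sub n : is_subgroup (poly_set n).
Proof.
elim: n => [|n IH]; first by split=> //= x y -> ->; rewrite mulgV.
split; first by apply: polyS; case: IH.
move=> _ _ [v [x [Pv Mx ->]]] [w [y [Pw My ->]]].
exists (v / w), (x / y); split; [exact: IH.2|exact: iM0.1.2|].
by rewrite divgACA_comm act_morph actV.
Qed.

(** Since c normalises H, an operator h can be moved past [c ^+ n] at the cost of a conjugation
    inside H. *)
Let poly_inv n h u : H h -> poly_set n u -> poly_set n (a u h).
Proof.
move=> Hh; elim: n u => [|n IH] u /=; first by move=> ->; rewrite act1g.
move=> [v [x [Pv Mx ->]]]; exists (a v h), (a x (h ^ (c ^- n))).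
split; [exact: IH|by apply: iM0.2 => //; case: (normHX n Hh)|].
by rewrite act_morph -!actM /conjg invgK !mulgA mulgVK.
Qed.

Let poly_shift n u : poly_set n u -> poly_set n.+1 (a u c).
Proof.
elim: n u => [|n IH] u.
  by move=> /= ->; exists 1, 1; rewrite !act1g mulg1; split=> //; case: iM0 => -[].
move=> [v [x [Pv Mx ->]]]; exists (a v c), x; split=> //; first exact: IH.
by rewrite act_morph -actM -expgSr.
Qed.

Let poly_shiftX n k u : poly_set n u -> poly_set (k + n) (a u (c ^+ k)).
Proof.
move=> Pu; elim: k => [|k IH]; first by rewrite act1.
by rewrite expgSr actM addSn; apply: poly_shift.
Qed.

Lemma sub_laurent_set : M0 `<=` laurent_set.
Proof. by move=> x Mx; exists 0%N, 1%N, 1, x; rewrite mul1g. Qed.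

Lemma laurent_inv : inv_subgroup H' laurent_set.
Proof.
split; first split.
- by exists 0%N, 0%N; rewrite act1g.
- move=> x y [k [n Px]] [k' [n' Py]].
  exists (k + k')%N, ((k' + n) + (k + n'))%N; rewrite act_morph actV.
  apply: (poly_sub _).2.
    by rewrite expgnDr actM; apply: poly_le (poly_shiftX k' Px); apply: leq_addr.
  rewrite [(k + k')%N]addnC expgnDr actM.
  by apply: poly_le (poly_shiftX k Py); exact: leq_addl.
move=> h x H'h Lx.
(* Closure under h and its inverse together makes N a subgroup, so it suffices to check c and H. *)
pose N := [set h | forall u, laurent_set u ->
  laurent_set (a u h) /\ laurent_set (a u h^-1)].
suff : N h by move=> /(_ x Lx) [].
apply: subgroup_genS (H'gen H'h).
  split=> [u Lu|g g' Ng Ng' u Lu]; first by rewrite invg1 act1.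
  rewrite invgF !actM; split; first by apply: (Ng' _ _).2; apply: (Ng _ Lu).1.
  by apply: (Ng _ _).2; apply: (Ng' _ Lu).1.
have LH g u : H g -> laurent_set u -> laurent_set (a u g).
  move=> Hg [k [n Pu]]; exists k, n.
  have [Hgk _] := normHX k Hg; have := poly_inv Hgk Pu.
  by rewrite -!actM /conjg mulVKg.
move=> g [->|Hg] u Lu; last by split; apply: LH => //; apply: subgroupV.
have [k [n Pu]] := Lu; split.
  by exists k, n.+1; rewrite -actM -expgS expgSr actM; apply: poly_shift.
by exists k.+1, n; rewrite -actM expgS mulKg.
Qed.

(** Hilbert's basis theorem for the skew variable c: leading coefficients form an ascending chain of
    H-submodules of the Noetherian M0. *)
Lemma laurent_noetherian : noetherian H' laurent_set.
Proof.
move=> L iL LM; have [sgL _] := iL.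
(* The coefficients of [c ^+ n] in the elements of D of degree at most n. Acting by c raises the
   degree, so they increase with n. *)
pose lead (D : set A) n :=
  [set m | M0 m /\ exists v, poly_set n v /\ D (v * a m (c ^+ n))].
have leadS D n : inv_subgroup H' D -> lead D n `<=` lead D n.+1.
  move=> iD m [Mm [v [Pv Dv]]]; split=> //; exists (a v c); split.
    exact: poly_shift.
  by rewrite expgSr actM -act_morph; apply: iD.2.
have lead_le D m n : inv_subgroup H' D -> m <= n -> lead D m `<=` lead D n.
  move=> iD /subnK <-; elim: (n - m) => [//|k IH] u Pu.
  by rewrite addSn; apply: leadS => //; apply: IH.
have lead_inv D n : inv_subgroup H' D -> inv_subgroup H (lead D n).
  move=> iD; split; first split.
  - split; first exact: iM0.1.1.
    by exists 1; rewrite act1g mulg1; split; [case: (poly_sub n)|exact: iD.1.1].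
  - move=> x y [Mx [v [Pv Dv]]] [My [w [Pw Dw]]]; split; first exact: iM0.1.2.
    exists (v / w); split; first exact: (poly_sub n).2.
    by rewrite act_morph actV -divgACA_comm; apply: iD.1.2.
  move=> h x Hh [Mx [v [Pv Dv]]]; split; first exact: iM0.2.
  have [Hhn _] := normHX n Hh.
  exists (a v (h ^ (c ^+ n))); split; first exact: poly_inv.
  have := iD.2 _ _ (HH' Hhn) Dv.
  by rewrite act_morph -!actM /conjg mulVKg.
have lead_gen n : exists s, op_generated H (lead L n) s.
  by apply: noethM0 => [|x []//]; apply: lead_inv.
have [sgen sgenP] := choice lead_gen.
pose U := [set m | exists n, lead L n m].
have iU : inv_subgroup H U.
  split; last by move=> h x Hh [n Ux]; exists n; apply: (lead_inv L n iL).2.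
  split; first by exists 0%N; exact: (lead_inv L 0%N iL).1.1.
  move=> x y [m Ux] [n Uy]; exists (m + n)%N.
  apply: (lead_inv L _ iL).1.2; first exact: lead_le (leq_addr _ _) _ Ux.
  exact: lead_le (leq_addl _ _) _ Uy.
have [s [sU sgenU]] : exists s, op_generated H U s.
  by apply: noethM0 => // x [n []].
(* The chain stabilises at N: the finitely many generators of its union all occur at one stage. *)
have [N sN] : exists N, [set` s] `<=` lead L N.
  have : forall x, x \in s -> U x by move=> x xs; apply: sU.
  elim: (s) => [|x s' IH] sU'; first by exists 0%N.
  have [n xn] := sU' x (mem_head _ _).
  have [|n' sn'] := IH; first by move=> y ys; apply: sU'; rewrite inE ys orbT.
  exists (n + n')%N => y /=; rewrite inE => /orP [/eqP ->|ys].
    exact: lead_le (leq_addr _ _) _ xn.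
  by apply: lead_le (leq_addl _ _) _ _; [|apply: sn'].
(* W collects elements of L realising the generators of the leading coefficients in every degree up
   to N. *)
have [W [WL Wlead]] : exists W : seq A, [set` W] `<=` L /\
    forall n m, n <= N -> m \in sgen n ->
      exists v, poly_set n v /\ v * a m (c ^+ n) \in W.
  have wit n : exists W : seq A, [set` W] `<=` L /\ forall m, m \in sgen n ->
      exists v, poly_set n v /\ v * a m (c ^+ n) \in W.
    have := (sgenP n).1; elim: (sgen n) => [|m ms IH] sub; first by exists [::].
    have [|W [WL Wm]] := IH; first by move=> y ys; apply: sub; rewrite /= inE ys orbT.
    have [_ [v [Pv Lv]]] := sub m (mem_head _ _).
    exists (v * a m (c ^+ n) :: W); split.
      by move=> y /=; rewrite inE => /orP [/eqP -> //|/WL].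
    move=> m'; rewrite inE => /orP [/eqP ->|/Wm [v' [Pv' W']]].
      by exists v; rewrite mem_head.
    by exists v'; rewrite inE W' orbT.
  have [W WP] := choice wit.
  exists (flatten [seq W n | n <- iota 0 N.+1]); split.
    by move=> y /flattenP [_ /mapP [n _ ->] yW]; apply: (WP n).1.
  move=> n m nN /(WP n).2 [v [Pv Wv]]; exists v; split=> //.
  apply/flattenP; exists (W n) => //; apply/mapP; exists n => //.
  by rewrite mem_iota.
exists W; split=> // D' iD' WD'; pose D := D' `&` L.
have iD : inv_subgroup H' D by apply: inv_subgroupI.
have WD : [set` W] `<=` D by move=> y Wy; split; [apply: WD'|apply: WL].
suff LD : L `<=` D by move=> u /LD [].
have leadD n : lead L n `<=` lead D n.
  have small k : k <= N -> lead L k `<=` lead D k.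
    move=> kN; apply: (sgenP k).2; first exact: lead_inv.
    move=> m ms; have [v [Pv Wv]] := Wlead k m kN ms.
    by split; [have [] := (sgenP k).1 m ms|exists v; split=> //; apply: WD].
  (* Beyond N, a leading coefficient of L already occurs in degree N, hence in D there, and shifting
     by c brings it up to degree n. *)
  have [nN|Nn] := leqP n N; first exact: small.
  move=> m Lm; apply: (lead_le D N) => //; first exact: ltnW.
  apply: small => //; apply: (sgenU _ (lead_inv L N iL) sN).
  by exists n.
(* Subtract an element of D with the same leading term and induct on the degree. *)
have polyD n u : poly_set n u -> L u -> D u.
  elim: n u => [|n IH] u; first by move=> /= -> _; case: iD => -[].
  move=> [v [m [Pv Mm e]]] Lu.
  have [_ [w [Pw Dw]]] : lead D n m.
    by apply: leadD; split=> //; exists v; rewrite -e.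
  have -> : u = (v / w) * (w * a m (c ^+ n)) by rewrite mulgA mulgVK -e.
  apply: subgroupM => //; first exact: iD.1.
  apply: IH; first exact: (poly_sub n).2.
  rewrite -(mulgKA (a m (c ^+ n)) v w) -e; apply: sgL.2 => //.
  by case: Dw.
move=> u Lu; have [k [n Pu]] := LM u Lu.
have : D (a u (c ^+ k)).
  apply: polyD Pu _; apply: iL.2 => //; exact: subgroupX.
move=> Dk; rewrite -[u](actK a (c ^+ k)); apply: iD.2 => //.
by apply: subgroupV => //; apply: subgroupX.
Qed.

End CyclicExtension.
End InvariantSubgroups.

(** * The lower central series and Hall's theorem for nilpotent operator groups *)

Section LowerCentral.
Variable F : groupType.
(** The index is shifted: [gam k] is $\gamma_{k+1}(F)$. *)
Local Notation gam := (@lower_central_rec F).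

Lemma lower_central_rec_subgroup k : is_subgroup (gam k).
Proof. exact: (lower_central_subgroup F k.+1). Qed.
Let sgam := lower_central_rec_subgroup.

Lemma lower_central_recR k x y : gam k x -> gam k.+1 [~ x, y].
Proof. by move=> gx; apply: sub_subgroup_gen; exists x => //; exists y. Qed.

Lemma lower_central_recJ k x g : gam k x -> gam k (x ^ g).
Proof.
elim: k x => [//|k IH] x.
apply: (@subgroup_genS _ _ [set x | gam k.+1 (x ^ g)]).
  split=> /= [|y z Hy Hz]; first by rewrite conj1g; case: (sgam k.+1).
  by rewrite conjMg conjVg; apply: (sgam k.+1).2.
move=> _ [y gy [z _ <-]]; rewrite /= conjRg.
apply: lower_central_recR; exact: IH.
Qed.

Lemma lower_central_recS k : gam k.+1 `<=` gam k.
Proof.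
apply: subgroup_genS => // _ [x gx [y _ <-]].
by apply: subgroupM => //; [apply: subgroupV|apply: lower_central_recJ].
Qed.

Hypothesis fgF : exists X : seq F, subgroup_gen [set` X] = [set: F].

(** Modulo the next term, commutators are multiplicative in each variable, so each factor is
    generated by the [[~ c, x]] with c from generators of the previous factor and x from generators
    of F. *)
Lemma lower_central_fg k : exists s : seq F,
  [set` s] `<=` gam k /\ gam k `<=` subgroup_gen (gam k.+1 `|` [set` s]).
Proof.
have [X genX] := fgF.
elim: k => [|k [s [sg gens]]].
  exists X; split=> // x _; have : subgroup_gen [set` X] x by rewrite genX.
  apply: subgroup_genS; first exact: subgroup_gen_subgroup.
  by move=> y Xy; apply: sub_subgroup_gen; right.
pose s' := [seq [~ c, x] | c <- s, x <- X].
have s'g : [set` s'] `<=` gam k.+1.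
  move=> _ /allpairsP [[c x] [/= cs _ ->]].
  by apply: lower_central_recR; apply: sg.
exists s'; split=> //.
set B := subgroup_gen _.
have sB : is_subgroup B := subgroup_gen_subgroup _.
have gB x : gam k.+2 x -> B x by move=> gx; apply: sub_subgroup_gen; left.
have Bg : B `<=` gam k.+1.
  by apply: subgroup_genS => // y [/lower_central_recS|/s'g].
(* B is normal because it lies between [gam k.+2] and [gam k.+1]. *)
have BJ x g : B x -> B (x ^ g).
  move=> Bx; rewrite -[x ^ g](mulVKg x); apply: (subgroupM sB) => //.
  by apply: gB; apply: lower_central_recR; apply: Bg.
have Bs c y : c \in s -> B [~ c, y].
  move=> cs; have : subgroup_gen [set` X] y by rewrite genX.
  apply: (@subgroup_genS _ _ [set y | B [~ c, y]]); last first.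
    move=> x Xx; apply: sub_subgroup_gen; right; apply/allpairsP.
    by exists (c, x).
  have RM x z : [~ c, x * z] = [~ c, z] * [~ c, x] ^ z.
    by rewrite /commg /conjg !invgM !mulgA !mulgK.
  apply: is_subgroupI => [|x z Bx Bz|x Bx] /=.
  - by rewrite commg1; case: sB.
  - by rewrite RM; apply: (subgroupM sB) => //; apply: BJ.
  - have := RM x x^-1; rewrite mulgV commg1 => /(congr1 (fun t => t / [~ c, x] ^ x^-1)).
    rewrite mulgK mul1g => <-; apply: (subgroupV sB); exact: BJ.
apply: subgroup_genS => // _ [x gx [y _ <-]].
suff : gam k x /\ forall y, B [~ x, y] by case.
have := gens _ gx.
apply: (@subgroup_genS _ _ [set x | gam k x /\ forall y, B [~ x, y]]).
  have RM (u v z : F) : [~ u * v, z] = [~ u, z] ^ v * [~ v, z].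
    by rewrite /commg /conjg !invgM !mulgA !mulgK.
  apply: is_subgroupI => [|u v [gu Bu] [gv Bv]|u [gu Bu]] /=.
  - by split; [exact: (sgam k).1|move=> z; rewrite comm1g; case: sB].
  - split=> [|z]; first exact: subgroupM.
    by rewrite RM; apply: (subgroupM sB) => //; apply: BJ.
  - split=> [|z]; first exact: subgroupV.
    have := RM u u^-1 z; rewrite mulgV comm1g => /(congr1 (fun t => ([~ u, z] ^ u^-1)^-1 * t)).
    by rewrite mulKg mulg1 => <-; apply: (subgroupV sB); exact: BJ.
move=> u [gu|us]; last by split; [exact: sg|move=> z; exact: Bs].
split; first exact: lower_central_recS.
by move=> z; apply: gB; apply: lower_central_recR.
Qed.

(** Start from the abelian group generated by s, on which [gam k] acts trivially, and enlarge the
    operator group up to F by one generator at a time, each a cyclic extension. *)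
Lemma nilpotent_noetherian (A : groupType) (a : gaction F A) (M : set A) k
    (s : seq A) :
  commutative (@mul A) -> inv_subgroup a [set: F] M ->
  op_generated a [set: F] M s ->
  (forall g x, gam k g -> M x -> a x g = x) ->
  noetherian a [set: F] M.
Proof.
move=> AC iM [sM Mgen] triv.
have base : exists M0, [/\ inv_subgroup a (gam k) M0, noetherian a (gam k) M0 &
    [set` s] `<=` M0].
  elim: s sM {Mgen} => [|b s IH] sM.
    exists [set 1]; split=> //.
      split; first by split=> //= x y -> ->; rewrite mulgV.
      by move=> h x _ /= ->; rewrite act1g.
    move=> L iL L1; exists [::]; split=> // L' [[L'1 _] _] _ x /L1 /= -> //.
  have [|M0 [iM0 nM0 sM0]] := IH.
    by move=> x xs; apply: sM; rewrite /= inE xs orbT.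
  have trivb h : gam k h -> a b h = b.
    by move=> gh; apply: triv => //; apply: sM; rewrite /= inE eqxx.
  exists (adjoin_gen M0 b); split.
  - exact: adjoin_gen_inv.
  - exact: adjoin_gen_noetherian.
  - move=> x /=; rewrite inE => /orP [/eqP ->|xs]; first exact: adjoin_gen_mem iM0.
    by apply: sub_adjoin_gen; apply: sM0.
have [M0 [iM0 nM0 sM0]] : exists M0, [/\ inv_subgroup a [set: F] M0,
    noetherian a [set: F] M0 & [set` s] `<=` M0].
  (* Climb from [gam k] to [gam 0], which is F, replacing M0 by a Laurent extension at each adjoined
     generator. *)
  rewrite -[[set: F]]/(gam 0); elim: k base {triv} => [//|k IH] [M0 [iM0 nM0 sM0]].
  apply: IH; have [t [tg gent]] := lower_central_fg k.
  pose H (t : seq F) := subgroup_gen (gam k.+1 `|` [set` t]).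
  have gH u : gam k.+1 `<=` H u by move=> x gx; apply: sub_subgroup_gen; left.
  have Hg u : [set` u] `<=` gam k -> H u `<=` gam k.
    move=> ug; apply: subgroup_genS; first exact: sgam.
    by move=> x [/lower_central_recS|/ug].
  have sH u : is_subgroup (H u) := subgroup_gen_subgroup _.
  (* Subgroups between [gam k.+1] and [gam k] are normal in F, so the next generator normalises what
     has been built. *)
  have HJ u x g : [set` u] `<=` gam k -> H u x -> H u (x ^ g).
    move=> ug Hx; rewrite -[x ^ g](mulVKg x); apply: (subgroupM (sH u)) => //.
    by apply: gH; apply: lower_central_recR; apply: (Hg u).
  have eH : H t = gam k by apply/seteqP; split; [exact: Hg|].
  rewrite -eH; elim: (t) tg {gent eH} => [_|c u IH ug].
    have -> : H [::] = gam k.+1.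
      apply/seteqP; split=> //; apply: subgroup_genS; first exact: sgam.
      by move=> x [].
    by exists M0.
  have ug' : [set` u] `<=` gam k.
    by move=> x xu; apply: ug; rewrite /= inE xu orbT.
  have [M1 [iM1 nM1 sM1]] := IH ug'.
  have HuHc : H u `<=` H (c :: u).
    apply: subgroup_genS => // x [/gH //|xu]; apply: sub_subgroup_gen; right.
    by rewrite /= inE xu orbT.
  have Hc : H (c :: u) c by apply: sub_subgroup_gen; right; rewrite /= inE eqxx.
  have Hgen : H (c :: u) `<=` subgroup_gen (c |` H u).
    apply: subgroup_genS; first exact: subgroup_gen_subgroup.
    move=> x [/(gH u) gx|]; first by apply: sub_subgroup_gen; right.
    rewrite /= inE => /orP [/eqP ->|xu]; apply: sub_subgroup_gen; first by left.
    by right; apply: sub_subgroup_gen; right.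
  have nH h : H u h -> H u (h ^ c) /\ H u (h ^ c^-1) by move=> Hh; split; apply: HJ.
  exists (laurent_set a M1 c); split.
  - exact: (laurent_inv AC (sH u) Hgen nH iM1).
  - exact: (laurent_noetherian AC (sH _) HuHc Hc nH iM1 nM1).
  - by move=> x /sM1; apply: sub_laurent_set.
(* The final M0 is F-invariant and contains s, hence contains M, and submodules of M are submodules
   of M0. *)
move=> L iL LM; apply: nM0 => // x /LM Mx.
exact: Mgen.
Qed.

End LowerCentral.

(** * Lifting subgroups of free groups *)

Notation free_group X := (presented (set0 : set (word X * word X))).

Section FreeSection.
Variables (X : choiceType) (G T : groupType).
Variables (pi : {hom free_group X -> G}) (lam : {hom T -> G}).
Local Notation F := (free_group X).

Let y (x : X) : G := pi (pres_gen set0 x).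
Let N : set G := range lam.

Let N1 : N 1. Proof. by exists 1; rewrite ?gmulf1. Qed.
Let NM g h : N g -> N h -> N (g * h).
Proof. by move=> [t _ <-] [u _ <-]; exists (t * u); rewrite ?gmulfM. Qed.
Let NV g : N g -> N g^-1.
Proof. by move=> [t _ <-]; exists t^-1; rewrite ?gmulfV. Qed.
Let NMl g h : N g -> N (g * h) = N h.
Proof.
move=> Ng; apply/propext; split; last exact: NM.
by move=> Ngh; rewrite -(mulKg g h); apply: NM => //; apply: NV.
Qed.

(* A transversal of the right cosets of N, with 1 representing N. *)
Let rep (g : G) : G := if `[< N g >] then 1 else xget 1 [set x | N (g / x)].

Let repP g : N (g / rep g).
Proof.
rewrite /rep; case: asboolP => Ng; first by rewrite divg1.
by apply: (@xgetPex _ 1 [set x | N (g / x)]); exists g; rewrite /= mulgV.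
Qed.

Let repM n g : N n -> rep (n * g) = rep g.
Proof.
move=> Nn; rewrite /rep NMl //; case: asboolP => // _; congr (xget _ _).
by apply/funext=> x; rewrite /= -mulgA (NMl _ Nn).
Qed.

Let rep1 g : N g -> rep g = 1.
Proof. by move=> Ng; rewrite /rep asboolT. Qed.

(** A lift to T of the Schreier generator read at the coset of g along the letter x. *)
Let tau (g : G) (x : X) : T :=
  xget 1 [set t | lam t = rep g * y x / rep (g * y x)].

Let tauP g x : lam (tau g x) = rep g * y x / rep (g * y x).
Proof.
apply: (@xgetPex _ 1 [set t | lam t = rep g * y x / rep (g * y x)]).
have : N ((g / rep g)^-1 * (g * y x / rep (g * y x))).
  by apply: NM; [apply: NV|]; apply: repP.
by rewrite invgF !mulgA mulgVK => -[t _ e]; exists t.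
Qed.

Let ev (p : bool * X) : G := if p.1 then (y p.2)^-1 else y p.2.

(** An inverse letter traverses backwards the edge of the coset graph that ends at g. *)
Let cocycle_letter (g : G) (p : bool * X) : T :=
  if p.1 then (tau (g / y p.2) p.2)^-1 else tau g p.2.

(* The Schreier cocycle: the Reidemeister-Schreier rewriting of w read from   *)
(* the coset N g, with each Schreier generator replaced by a lift to T.       *)
Fixpoint cocycle (g : G) (w : word X) : T :=
  if w is p :: w' then cocycle_letter g p * cocycle (g * ev p) w' else 1.

Let eval w : G := word_eval y w.

Let eval_cons p w : eval (p :: w) = ev p * eval w. Proof. by []. Qed.

Let cocycle_cons g p w :
  cocycle g (p :: w) = cocycle_letter g p * cocycle (g * ev p) w.
Proof. by []. Qed.

Let cocycle_cat g u v :
  cocycle g (u ++ v) = cocycle g u * cocycle (g * eval u) v.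
Proof.
elim: u g => [|p u IH] g; first by rewrite /= mul1g mulg1.
by rewrite cat_cons eval_cons 2!cocycle_cons IH !mulgA.
Qed.

Let eval_equiv u v : word_equiv set0 u v -> eval u = eval v.
Proof. exact: word_eval_equiv. Qed.

Let cocycle_equiv u v : word_equiv set0 u v -> forall g, cocycle g u = cocycle g v.
Proof.
elim=> // [u1 v1 w1 _ IH _ IH' g|u1 u2 v1 v2 e1 IH _ IH' g|b x g].
- by rewrite IH IH'.
- by rewrite !cocycle_cat IH IH' (eval_equiv e1).
- case: b; rewrite /= /cocycle_letter /ev /= mulg1; first by rewrite mulVg.
  by rewrite mulgK mulgV.
Qed.

Let lam_cocycle g w : lam (cocycle g w) = rep g * eval w / rep (g * eval w).
Proof.
elim: w g => [|p w IH] g.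
  by rewrite gmulf1 /eval /= !mulg1 mulgV.
have lamM : lam (cocycle_letter g p * cocycle (g * ev p) w) =
    (rep g * ev p / rep (g * ev p)) * lam (cocycle (g * ev p) w).
  rewrite gmulfM; congr (_ * _); rewrite /cocycle_letter /ev.
  by case: p.1; rewrite ?gmulfV tauP // mulgVK invgF invgM mulgA.
by rewrite cocycle_cons lamM IH eval_cons !mulgA mulgVK.
Qed.

Let pi_eval w : pi (word_class set0 w) = eval w.
Proof.
elim: w => [|[b x] w IH]; first exact: gmulf1.
rewrite -cat1s word_class_cat gmulfM IH; congr (_ * _); case: b => //=.
rewrite -[[:: _]]/(word_inv (letter x)) word_class_inv.
exact: gmulfV.
Qed.

Let sigma (a : F) : T := cocycle 1 (repr a).

(** The preimage of N in F is free, so pi lifts to T over it. The lift is the cocycle read from the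
    trivial coset, defined on all of F and multiplicative when the left factor lies in that
    preimage. *)
Lemma free_section : exists sigma : F -> T,
  (forall a, N (pi a) -> lam (sigma a) = pi a) /\
  (forall a b, N (pi a) -> sigma (a * b) = sigma a * sigma b).
Proof.
have piE a : pi a = eval (repr a).
  by rewrite -pi_eval /word_class reprK.
exists sigma; split=> [a Na|a b Na].
  by rewrite lam_cocycle -piE mul1g (rep1 Na) (rep1 N1) mul1g divg1.
rewrite /sigma (cocycle_equiv (word_equiv_repr _ _)) cocycle_cat -piE mul1g.
congr (_ * _).
(* The cocycle depends on its base point only through the coset modulo N. *)
suff E g w : cocycle (pi a * g) w = cocycle g w by rewrite -[pi a]mulg1 E.
elim: w g => [//|p w IH] g; rewrite 2!cocycle_cons -mulgA IH; congr (_ * _).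
have tauM h x : tau (pi a * h) x = tau h x.
  by rewrite /tau -(mulgA (pi a)) !(repM _ Na).
by rewrite /cocycle_letter -mulgA !tauM.
Qed.

End FreeSection.

(** * Kernels of crossed modules *)

Section CoinducedModule.
Variables (F G : groupType) (M : xmod G).
Local Notation T := (xm_car M).
Local Notation lam := (xm_lambda M).

Lemma xmod_kernel_central (t u : T) : lam t = 1 -> t * u = u * t.
Proof.
by move=> t1; rewrite [RHS]conjgC -xm_peiffer t1 act1.
Qed.

(* The functions from F to ker lambda, with (phi . g) x = phi (g x).          *)
Record coind : Type := Coind {
  coind_fun :> F -> T;
  coindP : forall x, lam (coind_fun x) = 1
}.

Lemma coind_eq (p q : coind) : (forall x, p x = q x) -> p = q.
Proof.
case: p q => [p pP] [q qP] /= /funext e; subst q; congr Coind.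
exact: Prop_irrelevance.
Qed.

HB.instance Definition _ := gen_eqMixin coind.
HB.instance Definition _ := gen_choiceMixin coind.

Fact coind_mulP (p q : coind) x : lam (p x * q x) = 1.
Proof. by rewrite gmulfM !coindP mulg1. Qed.
Fact coind_invP (p : coind) x : lam (p x)^-1 = 1.
Proof. by rewrite gmulfV coindP invg1. Qed.
Definition coind_mul p q := Coind (coind_mulP p q).
Definition coind_inv p := Coind (coind_invP p).
Definition coind_one := @Coind (fun=> 1) (fun=> gmulf1).

Lemma coind_mulA : associative coind_mul.
Proof. by move=> p q r; apply: coind_eq => x; apply: mulgA. Qed.
Lemma coind_mul1 : left_id coind_one coind_mul.
Proof. by move=> p; apply: coind_eq => x; apply: mul1g. Qed.
Lemma coind_mulr1 : right_id coind_one coind_mul.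
Proof. by move=> p; apply: coind_eq => x; apply: mulg1. Qed.
Lemma coind_mulV : left_inverse coind_one coind_inv coind_mul.
Proof. by move=> p; apply: coind_eq => x; apply: mulVg. Qed.
Lemma coind_mulrV : right_inverse coind_one coind_inv coind_mul.
Proof. by move=> p; apply: coind_eq => x; apply: mulgV. Qed.

HB.instance Definition _ := isGroup.Build coind
  coind_mulA coind_mul1 coind_mulr1 coind_mulV coind_mulrV.

Lemma coind_mulC : commutative (@mul coind).
Proof.
by move=> p q; apply: coind_eq => x; apply: xmod_kernel_central; apply: coindP.
Qed.

Definition coind_act_fun (p : coind) (g : F) : coind :=
  @Coind (fun x => p (g * x)) (fun x => coindP p (g * x)).
Lemma coind_act1 p : coind_act_fun p 1 = p.
Proof. by apply: coind_eq => x /=; rewrite mul1g. Qed.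
Lemma coind_actM p g h :
  coind_act_fun p (g * h) = coind_act_fun (coind_act_fun p g) h.
Proof. by apply: coind_eq => x /=; rewrite mulgA. Qed.
Lemma coind_act_morph g : {morph coind_act_fun^~ g : p q / p * q}.
Proof. by move=> p q; apply: coind_eq. Qed.
Definition coind_action : gaction F coind :=
  GAction coind_act1 coind_actM coind_act_morph.

End CoinducedModule.

Section KernelGeneration.
Variables (F G : groupType) (M : xmod G) (k : nat).
Variables (pi : {hom F -> G}) (sigma : F -> xm_car M).
Local Notation T := (xm_car M).
Local Notation lam := (xm_lambda M).
Local Notation act := (xm_act M).
Local Notation A := (coind F M).
Hypothesis fgF : exists X : seq F, subgroup_gen [set` X] = [set: F].
Hypothesis pi_surj : forall g, exists f, pi f = g.
Hypothesis fgR : exists R : seq F, op_generated (conj_action F) [set: F] (kernel pi) R.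
Hypothesis fgT : exists s : seq T, op_generated act [set: G] [set: T] s.
Hypothesis nilp : @lower_central_rec G k `<=` range lam.
Hypothesis sigmaP : forall a, range lam (pi a) -> lam (sigma a) = pi a.
Hypothesis sigmaM :
  forall a b, range lam (pi a) -> sigma (a * b) = sigma a * sigma b.

Let cen := @xmod_kernel_central G M.

Let piN t f : lam t = pi f -> range lam (pi f).
Proof. by move=> e; exists t. Qed.

Let N1 : range lam (pi 1). Proof. by apply: (@piN 1); rewrite !gmulf1. Qed.

Let sigma1 : sigma 1 = 1.
Proof. by apply: (mulgI (sigma 1)); rewrite -sigmaM // !mulg1. Qed.

Let sigmaV a : range lam (pi a) -> sigma a^-1 = (sigma a)^-1.
Proof.
by move=> Na; apply: (mulgI (sigma a)); rewrite -sigmaM // !mulgV sigma1.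
Qed.

(* The equivariant extension of (t, f) |-> t / sigma f, defined on the        *)
(* fibre product of T and F over G and constant elsewhere.                    *)
Let coef (t : T) (f x : F) : T :=
  if lam t == pi f then act t (pi x) / sigma (f ^ x) else 1.

Let lamJ t f x : lam t = pi f -> lam (act t (pi x)) = pi (f ^ x).
Proof. by move=> e; rewrite xm_equiv e gmulfJ. Qed.

Let coefP t f x : lam (coef t f x) = 1.
Proof.
rewrite /coef; case: eqP => [e|_]; last exact: gmulf1.
rewrite gmulfM gmulfV (lamJ _ e) sigmaP ?mulgV //.
exact: piN (lamJ x e).
Qed.

Let cf (t : T) (f : F) : A := Coind (coefP t f).

Let cfE t f x : lam t = pi f -> cf t f x = act t (pi x) / sigma (f ^ x).
Proof. by move=> e; rewrite /= /coef e eqxx. Qed.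

(** The quotient of t' by the lift of f' lies in the central kernel, so it can be moved past the
    other factors. *)
Let cfM t t' f f' : lam t = pi f -> lam t' = pi f' ->
  cf (t * t') (f * f') = cf t f * cf t' f'.
Proof.
move=> e e'; apply: coind_eq => x; rewrite -[RHS]/(cf t f x * cf t' f' x).
have c := coefP t' f' x; rewrite -[coef _ _ _]/(cf t' f' x) in c.
rewrite cfE ?gmulfM ?e ?e' // conjMg sigmaM; last exact: piN (lamJ x e).
rewrite act_morph invgM mulgA -(mulgA (act t _)) -(cfE x e') -mulgA (cen _ c).
by rewrite mulgA -cfE.
Qed.

Let cf1 : cf 1 1 = 1.
Proof.
apply: coind_eq => x; rewrite cfE ?gmulf1 //.
by rewrite act1g conj1g sigma1 mulgV.
Qed.

Let cfV t f : lam t = pi f -> cf t^-1 f^-1 = (cf t f)^-1.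
Proof.
move=> e; apply: (mulgI (cf t f)); rewrite -cfM // ?gmulfV ?e //.
by rewrite !mulgV cf1.
Qed.

Let cfJ t f g : lam t = pi f ->
  coind_action F M (cf t f) g = cf (act t (pi g)) (f ^ g).
Proof.
move=> e; apply: coind_eq => x; rewrite -[LHS]/(cf t f (g * x)).
by rewrite !cfE //; [rewrite gmulfM actM conjgM|exact: lamJ].
Qed.

(** The image of the fibre product of T and F over G in the module of functions. *)
Let Mset : set A := [set p | exists t f, lam t = pi f /\ p = cf t f].

Let Mset_inv : inv_subgroup (coind_action F M) [set: F] Mset.
Proof.
split; last first.
  move=> g _ _ [t [f [e ->]]]; exists (act t (pi g)), (f ^ g).
  by rewrite cfJ //; split=> //; apply: lamJ.
split; first by exists 1, 1; rewrite cf1 !gmulf1.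
move=> _ _ [t [f [e ->]]] [t' [f' [e' ->]]]; exists (t / t'), (f / f').
by rewrite cfM ?cfV // ?gmulfM ?gmulfV ?e ?e'.
Qed.

(** The fibre product is generated over F by lifts of the generators of T and by the pairs (1, r)
    with r among the normal generators of the kernel of pi; finite presentation enters here. *)
Let Mset_gen : exists s, op_generated (coind_action F M) [set: F] Mset s.
Proof.
have [R [RK Rgen]] := fgR; have [s [_ sgen]] := fgT.
have [pre preP] := choice pi_surj.
exists ([seq cf t (pre (lam t)) | t <- s] ++ [seq cf 1 r | r <- R]).
split.
  move=> p; rewrite /= mem_cat => /orP [/mapP [t _ ->]|/mapP [r rR ->]].
    by exists t, (pre (lam t)); rewrite preP.
  by exists 1, r; rewrite gmulf1 -(RK r).
move=> L iL sL; have [sgL _] := iL.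
have Lt t : t \in s -> L (cf t (pre (lam t))).
  move=> ts; apply: sL; rewrite /= mem_cat; apply/orP; left.
  by apply/mapP; exists t.
have Lr r : r \in R -> L (cf 1 r).
  move=> rR; apply: sL; rewrite /= mem_cat; apply/orP; right.
  by apply/mapP; exists r.
have LK f : pi f = 1 -> L (cf 1 f).
  move=> f1; suff : [set f | pi f = 1 /\ L (cf 1 f)] f by case.
  apply: Rgen (f1); last by move=> r rR; split; [apply: RK|apply: Lr].
  split; last first.
    move=> g x _ [x1 Lx]; split; first by rewrite gmulfJ x1 conj1g.
    rewrite -(act1g act (pi g)) -cfJ ?gmulf1 //; exact: iL.2.
  split; first by rewrite /= gmulf1 cf1; split=> //; case: sgL.
  move=> x y [x1 Lx] [y1 Ly]; split; first by rewrite gmulfM gmulfV x1 y1 mulgV.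
  rewrite -[1](mulgV 1) cfM ?cfV ?gmulfV ?gmulf1 ?x1 ?y1 ?invg1 //.
  exact: sgL.2.
have LT t : exists f, lam t = pi f /\ L (cf t f).
  have : [set: T] t by [].
  apply: (sgen [set t | exists f, lam t = pi f /\ L (cf t f)]); last first.
    by move=> u us; exists (pre (lam u)); rewrite preP; split=> //; apply: Lt.
  split; last first.
    move=> g x _ [f [e Lf]]; have [h <-] := pi_surj g.
    by exists (f ^ h); split; [apply: lamJ|rewrite -cfJ //; apply: iL.2].
  split; first by exists 1; rewrite cf1 !gmulf1; split=> //; case: sgL.
  move=> x y [f [e Lf]] [f' [e' Lf']]; exists (f / f').
  rewrite !gmulfM !gmulfV e e' cfM ?cfV ?gmulfV ?e' //; split=> //.
  exact: sgL.2.
move=> _ [t [f [e ->]]]; have [f' [e' Lf']] := LT t.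
have ff' : pi (f'^-1 * f) = 1 by rewrite gmulfM gmulfV -e -e' mulVg.
(* Two pairs over the same t differ by a pair (1, r) with r in the kernel of pi. *)
rewrite -[t]mulg1 -[f](mulVKg f') cfM ?gmulf1 //.
by apply: subgroupM => //; apply: LK.
Qed.

(** An element s of F with [pi s] in the image of [lam] acts on both t and the lift of f as
    conjugation by [sigma s], which fixes the central quotient of the two. *)
Let Mset_triv g p : lower_central_rec k g -> Mset p -> coind_action F M p g = p.
Proof.
move=> gk [t [f [e ->]]]; apply: coind_eq => x.
rewrite -[LHS]/(cf t f (g * x)) conjgC.
have : range lam (pi (g ^ x)).
  apply: nilp; have : lower_central_rec k (g ^ x) by apply: lower_central_recJ.
  elim: (k) (g ^ x) => [//|j IH] z.
  apply: (@subgroup_genS _ _ [set z | lower_central_rec j.+1 (pi z)]).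
    have sj := @lower_central_rec_subgroup G j.+1.
    split=> [|u v gu gv]; rewrite /= ?gmulf1; first exact: sj.1.
    by rewrite gmulfM gmulfV; apply: sj.2.
  move=> _ [u gu [v _ <-]]; rewrite /= gmulfR.
  by apply: lower_central_recR; apply: IH.
move: (g ^ x) => s Ns; rewrite !cfE // conjgM.
rewrite [in LHS]/conjg sigmaM; last first.
  by rewrite gmulfV; case: Ns => u _ <-; exists u^-1; rewrite ?gmulfV.
rewrite sigmaM; last exact: piN (lamJ x e).
rewrite sigmaV // gmulfM actM -(sigmaP Ns) xm_peiffer.
rewrite -[(sigma s)^-1 * _]/(sigma (f ^ x) ^ sigma s) -conjVg -conjMg.
rewrite -(cfE x e) /conjg; have /cen -> := coefP t f x.
exact: mulKg.
Qed.

(** On the kernel, [cf u 1] is the orbit map of u, so u is recovered by evaluation at 1. The kernel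
    thus becomes a submodule L of the Noetherian [Mset], and evaluating generators of L at 1 gives
    generators of the kernel. *)
Lemma xmod_kernel_op_generated :
  exists s, op_generated act [set: G] (kernel lam) s.
Proof.
have [s0 s0gen] := Mset_gen.
have noeth := nilpotent_noetherian fgF (@coind_mulC F G M) Mset_inv s0gen Mset_triv.
pose L : set A := [set p | exists u, lam u = 1 /\ p = cf u 1].
have ku u : lam u = 1 -> lam u = pi 1 by rewrite gmulf1.
have cfu u x : lam u = 1 -> cf u 1 x = act u (pi x).
  by move=> u1; rewrite (cfE x (ku u u1)) conj1g sigma1 divg1.
have LM : L `<=` Mset by move=> _ [u [u1 ->]]; exists u, 1; split=> //; exact: ku.
have iL : inv_subgroup (coind_action F M) [set: F] L.
  split; last first.
    move=> g _ _ [u [u1 ->]]; exists (act u (pi g)).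
    by rewrite (cfJ _ (ku u u1)) conj1g xm_equiv u1 conj1g.
  split; first by exists 1; rewrite cf1 gmulf1.
  move=> _ _ [u [u1 ->]] [v [v1 ->]]; exists (u / v).
  have vV : lam v^-1 = pi 1^-1 by rewrite !gmulfV v1 gmulf1.
  split; first by rewrite gmulfM gmulfV u1 v1 mulgV.
  by rewrite -(cfV (ku v v1)) -(cfM (ku u u1) vV) mulgV.
have [s [sL sgen]] := noeth L iL LM.
exists [seq p 1 | p : A <- s]; split.
  by move=> t /= /mapP [p /sL [u [u1 ->]] ->]; rewrite cfu // gmulf1 act1.
move=> L' iL' sL' u u1.
pose D := [set p : A | L p /\ L' (p 1)].
suff : D (cf u 1) by case=> _; rewrite cfu // gmulf1 act1.
apply: (sgen D); last by exists u.
  split; last first.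
    move=> g _ _ [[v [v1 ->]] Lv]; split; first by apply: iL.2 => //; exists v.
    rewrite -[X in L' X]/(cf v 1 (g * 1)) mulg1 cfu //.
    by apply: iL'.2 => //; rewrite cfu // gmulf1 act1 in Lv.
  split; first by split; [exact: iL.1.1|exact: iL'.1.1].
  by move=> p q [Lp Lp'] [Lq Lq']; split; [exact: iL.1.2|exact: iL'.1.2].
by move=> p ps; split; [exact: sL|apply: sL'; rewrite /= (map_f (fun p : A => p 1))].
Qed.

End KernelGeneration.

(** * Tensor powers *)

Section NextPowerGeneration.
Variables (G : groupType) (M : xmod G).
Local Notation T := (xm_car M).
Local Notation a := (xm_act M).
Local Notation lam := (xm_lambda M).
Local Notation TG := (tensor (xm_compatible M)).
Local Notation "t ** g" := (tens (xm_compatible M) t g) (at level 40).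
Local Notation da := (diag_action M).
Local Notation nlam := (next_lambda M).

Lemma tensor_ind (P : TG -> Prop) :
  P 1 -> (forall x y, P x -> P y -> P (x * y)) -> (forall x, P x -> P x^-1) ->
  (forall t g, P (t ** g)) -> forall z, P z.
Proof.
move=> P1 PM PV Pt; elim/pres_ind => // -[t g] z Pz; apply: PM => //.
  exact: Pt.
by apply: PV; apply: Pt.
Qed.

(** Through the Peiffer identity the defining relation becomes a crossed-homomorphism rule for the
    diagonal action. *)
Lemma tens_mull t u g : (t * u) ** g = da (t ** g) (lam u) * (u ** g).
Proof. by rewrite tensMl -xm_peiffer -[da _ _]/(diag_act _ _) diag_actE. Qed.

Lemma tens_mulr t g h : t ** (g * h) = (t ** h) * da (t ** g) h.
Proof. by rewrite tensMr -[da _ _]/(diag_act _ _) diag_actE. Qed.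

Lemma tens1l g : 1 ** g = 1 :> TG.
Proof.
have := tens_mull 1 1 g; rewrite mulg1 gmulf1 act1 => e.
by apply: (mulgI (1 ** g)); rewrite mulg1 -e.
Qed.

Lemma tens1r t : t ** 1 = 1 :> TG.
Proof.
have := tens_mulr t 1 1; rewrite mulg1 act1 => e.
by apply: (mulgI (t ** 1)); rewrite mulg1 -e.
Qed.

Lemma tens_invl t g : t^-1 ** g = da (t ** g)^-1 (lam t^-1).
Proof.
apply: (mulgI (da (t ** g) (lam t^-1))).
by rewrite -tens_mull -act_morph mulgV tens1l mulgV act1g.
Qed.

Lemma tens_invr t g : t ** g^-1 = da (t ** g)^-1 g^-1.
Proof.
apply: (mulIg (da (t ** g) g^-1)).
have := tens_mulr t g g^-1; rewrite mulgV tens1r => e.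
by rewrite -e -act_morph mulVg act1g.
Qed.

(** The tensors of generators suffice: by the crossed rules, the t with every [t ** g] in L form an
    invariant subgroup of T. *)
Lemma next_power_op_generated (X : seq G) :
  subgroup_gen [set` X] = [set: G] ->
  (exists s, op_generated a [set: G] [set: T] s) ->
  exists s, op_generated da [set: G] [set: TG] s.
Proof.
move=> genX [s [_ sgen]].
exists [seq t ** x | t <- s, x <- X]; split=> // L iL sL z _; have [sgL _] := iL.
have LJ w g : L w -> L (da w g) by apply: iL.2.
suff Lt t g : L (t ** g).
  elim/tensor_ind: z => //; first by case: sgL.
    by move=> x y; apply: (subgroupM sgL).
  by move=> x; apply: (subgroupV sgL).
suff : [set t | forall g, L (t ** g)] t by apply.
apply: sgen => //; last first.
  move=> u us {}g; apply: (@group_ind_gen _ _ (fun g => L (u ** g)) genX) => [x Xx||x y Lx Ly|x Lx].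
  - by apply: sL; apply/allpairsP; exists (u, x).
  - by rewrite tens1r; case: sgL.
  - by rewrite tens_mulr; apply: (subgroupM sgL) => //; apply: LJ.
  - by rewrite tens_invr; apply: LJ; apply: (subgroupV sgL).
split; last first.
  move=> g' u _ Lu {}g; rewrite -[g](conjgKV g') -diag_actE.
  exact: LJ.
apply: is_subgroupI => [|u v Lu Lv|u Lu] h.
- by rewrite tens1l; case: sgL.
- by rewrite tens_mull; apply: (subgroupM sgL) => //; apply: LJ.
- by rewrite tens_invl; apply: LJ; apply: (subgroupV sgL).
Qed.

Lemma commutator_map_fl (t u : T) (g : G) :
  (t * u)^-1 * a (t * u) g =
  (t ^ u)^-1 * a (t ^ u) (lambda_action M g u) * (u^-1 * a u g).
Proof.
rewrite act_morph /= /lambda_act -[t ^ u]xm_peiffer -actM.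
have -> : lam u * g ^ lam u = g * lam u by rewrite /conjg !mulgA mulgV mul1g.
by rewrite actM !xm_peiffer -conjVg -conjMg {1}/conjg !invgM !mulgA mulgK.
Qed.

Lemma commutator_map_fr (t : T) (g h : G) :
  t^-1 * a t (g * h) = (t^-1 * a t h) * ((a t h)^-1 * a (a t h) (g ^ h)).
Proof. by rewrite mulgA mulgK -actM -conjgC. Qed.

(** The commutator of t and g formed in T instead of G; it factors [nlam] through [lam]. *)
Definition commutator_map : {hom TG -> T} :=
  tens_lift (A := xm_compatible M) (f := fun t g => t^-1 * a t g)
    commutator_map_fl commutator_map_fr.
Local Notation mu := commutator_map.

Lemma commutator_mapE t g : mu (t ** g) = t^-1 * a t g.
Proof. exact: tens_liftE. Qed.

Lemma lambda_commutator_map z : lam (mu z) = nlam z.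
Proof.
elim/tensor_ind: z => [|x y ex ey|x ex|t g]; rewrite ?gmulf1 //.
- by rewrite !gmulfM ex ey.
- by rewrite !gmulfV ex.
- by rewrite commutator_mapE next_lambdaE gmulfM gmulfV xm_equiv.
Qed.

(** Both sides obey the same product rule in z, by the Peiffer identity of the next power; on a
    generator [t ** h] the claim follows from two expansions of [t ** (h * g)]. *)
Lemma tens_commutator_map z g : mu z ** g = z^-1 * da z g.
Proof.
have M_step x y : mu x ** g = x^-1 * da x g -> mu y ** g = y^-1 * da y g ->
    mu (x * y) ** g = (x * y)^-1 * da (x * y) g.
  move=> ex ey; rewrite gmulfM tens_mull ex ey lambda_commutator_map.
  by rewrite (next_peiffer _ y) act_morph /conjg invgM !mulgA mulgK.
elim/tensor_ind: z => [|x y|x ex|t h].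
- by rewrite gmulf1 tens1l act1g mulVg.
- exact: M_step.
- rewrite gmulfV tens_invl ex gmulfV lambda_commutator_map -gmulfV.
  by rewrite (next_peiffer _ x^-1) actV /conjg !invgK invgM invgK !mulgA mulgK.
rewrite commutator_mapE tens_mull tens_invl -actM -gmulfM.
have -> : da (t ** g)^-1 (lam (t^-1 * a t h)) = (t ** g)^-1 ^ (t ** h).
  by rewrite -commutator_mapE lambda_commutator_map (next_peiffer _ (t ** h)).
have e : (t ** h) * (a t h ** g) = (t ** g) * da (t ** h) g.
  by rewrite -tens_mulr conjgCV tens_mulr -[da _ h]/(diag_act _ _) diag_actE conjgKV.
by rewrite /conjg -!mulgA e mulKg.
Qed.

(** The group B generated by the module generators s and the tensors [t ** x], with t in j and x in
    X, is G-invariant: z and its translate by g differ by [mu z ** g], and [mu z] lies in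
    [kernel lam]. *)
Lemma next_power_kernel_fg (X : seq G) :
  subgroup_gen [set` X] = [set: G] ->
  finitely_generated (kernel lam) ->
  (exists s, op_generated da [set: G] (kernel nlam) s) ->
  finitely_generated (kernel nlam).
Proof.
move=> genX [j Jgen] [s [sK sgen]].
have jK : [set` j] `<=` kernel lam by rewrite Jgen; exact: sub_subgroup_gen.
pose b := [seq t ** x | t <- j, x <- X].
have muK z : kernel nlam z -> kernel lam (mu z).
  by rewrite /kernel /= lambda_commutator_map.
exists (s ++ b); set B := subgroup_gen _.
have sgB : is_subgroup B := subgroup_gen_subgroup _.
have Jnl t g : kernel lam t -> kernel nlam (t ** g).
  by rewrite /kernel /= next_lambdaE => ->; rewrite comm1g.
have BK : B `<=` kernel nlam.
  apply: subgroup_genS => [|z].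
    by split=> [|x y x1 y1]; rewrite /kernel /= ?gmulf1 // gmulfM gmulfV x1 y1 mulgV.
  rewrite /= mem_cat => /orP [/sK //|/allpairsP [[t x] [/= tj _ ->]]].
  exact/Jnl/jK.
have Bs z : z \in s -> B z.
  by move=> zs; apply: sub_subgroup_gen; rewrite /= mem_cat zs.
have BJ t g : kernel lam t -> B (t ** g).
  have daE z h : da z h = z * (mu z ** h) by rewrite tens_commutator_map mulVKg.
  (* The induction on g is uniform in t, because expanding a product replaces t by [mu (t ** g)],
     again in [kernel lam]. *)
  move: g t; apply: (@group_ind_gen _ _ (fun g =>
      forall t, kernel lam t -> B (t ** g)) genX) => [x Xx t||g h Bg Bh t t1|g Bg t t1].
  - rewrite Jgen => jt; suff : kernel lam t /\ B (t ** x) by case.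
    (* On [kernel lam] the twist in [tens_mull] is trivial, so tensoring with x is a homomorphism
       there. *)
    move: t jt; apply: subgroup_gen_ind => [t tj||t u [t1 Bt] [u1 Bu]|t [t1 Bt]].
    + split; first exact: jK.
      apply: sub_subgroup_gen; rewrite /= mem_cat; apply/orP; right.
      by apply/allpairsP; exists (t, x).
    + by rewrite /kernel /= gmulf1 tens1l; split=> //; case: sgB.
    + rewrite /kernel /= gmulfM t1 u1 mulg1; split=> //.
      by rewrite tens_mull u1 act1; apply: (subgroupM sgB).
    + rewrite /kernel /= gmulfV t1 invg1; split=> //.
      by rewrite tens_invl gmulfV t1 invg1 act1; apply: (subgroupV sgB).
  - by move=> t _; rewrite tens1r; case: sgB.
  - rewrite tens_mulr daE; apply: (subgroupM sgB) => //; first exact: Bh.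
    apply: (subgroupM sgB) => //; first exact: Bg.
    by apply: Bh; apply: muK; apply: Jnl.
  - have := tens_mulr t g^-1 g; rewrite mulVg tens1r daE => /esym e.
    have -> : t ** g^-1 = (t ** g)^-1 * (mu (t ** g^-1) ** g)^-1.
      apply: (mulgI (t ** g)); apply: (mulIg (mu (t ** g^-1) ** g)).
      by rewrite -mulgA e mulVKg mulVg.
    apply: (subgroupM sgB) => //; apply: (subgroupV sgB) => //; apply: Bg => //.
    by apply: muK; apply: Jnl.
apply/seteqP; split=> //.
apply: sgen; last exact: Bs.
split=> // g z _ Bz; rewrite -[da z g](mulVKg z) -tens_commutator_map.
apply: (subgroupM sgB) => //; apply: BJ; apply: muK; exact: BK.
Qed.

End NextPowerGeneration.

Lemma lower_central_sub_range (G : groupType) m :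
  @lower_central_rec G m `<=` range (xm_lambda (tensor_power_rec G m)).
Proof.
elim: m => [|m IH]; first by move=> x _; exists x.
apply: subgroup_genS => [|_ [x /IH [t _ <-] [y _ <-]]]; last first.
  by exists (tens _ t y) => //; apply: next_lambdaE.
split; first by exists 1; rewrite ?gmulf1.
by move=> _ _ [t _ <-] [u _ <-]; exists (t / u); rewrite ?gmulfM ?gmulfV.
Qed.

(** * Finite presentations and the induction on tensor powers *)

Section FinitelyPresented.
Variables (m : nat) (R : seq (word 'I_m * word 'I_m)) (G : groupType).
Variable f : {hom presented [set` R] -> G}.
Hypothesis bij_f : bijective f.
Local Notation F := (free_group 'I_m).

Let freeR : respects (set0 : set (word 'I_m * word 'I_m))
  (fun i => f (pres_gen [set` R] i)).
Proof. by []. Qed.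

Definition presentation_hom : {hom F -> G} := pres_lift freeR.
Local Notation pi := presentation_hom.

Lemma free_group_fg : exists X : seq F, subgroup_gen [set` X] = [set: F].
Proof.
exists [seq pres_gen set0 i | i <- enum 'I_m]; apply/seteqP; split=> // a _.
have sg := @subgroup_gen_subgroup F [set` [seq pres_gen set0 i | i <- enum 'I_m]].
have gen i : subgroup_gen [set` [seq pres_gen set0 i | i <- enum 'I_m]]
    (pres_gen set0 i : F).
  by apply: sub_subgroup_gen; apply: map_f; rewrite mem_enum.
elim/pres_ind: a => [|i a La|i a La]; first by case: sg.
- exact: (subgroupM sg).
- by apply: (subgroupM sg) => //; apply: (subgroupV sg).
Qed.

Lemma presentation_hom_class w : pi (word_class set0 w) = f (word_class [set` R] w).
Proof.
elim: w => [|[b i] w IH]; first by rewrite !gmulf1.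
rewrite -cat1s !word_class_cat !gmulfM IH; congr (_ * _); case: b.
  rewrite -[[:: _]]/(word_inv (letter i)) !word_class_inv !gmulfV.
  by congr _^-1; exact: pres_lift_gen.
exact: pres_lift_gen.
Qed.

Lemma presentation_hom_surj g : exists a, pi a = g.
Proof.
have [h _ fh] := bij_f; rewrite -(fh g).
elim/presW: (h g) => w; exists (word_class set0 w).
exact: presentation_hom_class.
Qed.

(** The kernel is the normal closure of the quotients of the two sides of the relations, by
    induction on a derivation of [word_equiv]. *)
Lemma presentation_kernel_op_generated :
  exists s, op_generated (conj_action F) [set: F] (kernel pi) s.
Proof.
exists [seq word_class set0 p.1 / word_class set0 p.2 | p <- R]; split.
  move=> _ /mapP [[l r] Rlr ->]; rewrite /kernel /= gmulfM gmulfV.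
  by rewrite !presentation_hom_class (word_class_rel Rlr) mulgV.
move=> L [sgL LJ] RL a; elim/presW: a => w.
rewrite /kernel /= presentation_hom_class => w1.
have : word_equiv [set` R] w [::].
  apply/word_classP; apply: (bij_inj bij_f); rewrite w1.
  by rewrite -[word_class _ [::]]/(1 : presented _) gmulf1.
suff E u v : word_equiv [set` R] u v -> L (word_class set0 u / word_class set0 v).
  by move=> /E; rewrite divg1.
have divC (x y : F) : L (x / y) -> L (y / x).
  by move=> Lxy; rewrite -invgF; apply: (subgroupV sgL).
elim=> [{}u|{}u {}v _|u1 u2 u3 _ IH _ IH'|u1 u2 v1 v2 _ IH _ IH'|b x|l r Rlr].
- by rewrite mulgV; case: sgL.
- exact: divC.
- rewrite -(divgKA (word_class set0 u2)); exact: (subgroupM sgL).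
- rewrite !word_class_cat.
  have -> : word_class set0 u1 * word_class set0 v1 /
      (word_class set0 u2 * word_class set0 v2) =
      (word_class set0 v1 / word_class set0 v2) ^ (word_class set0 u1)^-1 *
      (word_class set0 u1 / word_class set0 u2) :> F.
    by rewrite /conjg invgK invgM !mulgA mulgVK.
  by apply: (subgroupM sgL) => //; apply: LJ.
- have -> : word_class set0 [:: (b, x); (~~ b, x)] = 1 :> F.
    by apply/word_classP/WordCancel.
  by rewrite mulgV; case: sgL.
- by apply: RL; apply/mapP; exists (l, r).
Qed.

Lemma presented_group_fg : exists X : seq G, subgroup_gen [set` X] = [set: G].
Proof.
have [X genX] := free_group_fg; exists [seq pi x | x <- X].
apply/seteqP; split=> // g _; have [a <-] := presentation_hom_surj g.
have sg := @subgroup_gen_subgroup G [set` [seq pi x | x <- X]].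
apply: (@group_ind_gen _ _ (fun a => subgroup_gen _ (pi a)) genX) => [x Xx||x y Lx Ly|x Lx].
- by apply: sub_subgroup_gen; apply: map_f.
- by rewrite gmulf1; case: sg.
- by rewrite gmulfM; apply: (subgroupM sg).
- by rewrite gmulfV; apply: (subgroupV sg).
Qed.

Lemma nilpotent_xmod_kernel_op_generated (M : xmod G) k :
  (exists s, op_generated (xm_act M) [set: G] [set: xm_car M] s) ->
  @lower_central_rec G k `<=` range (xm_lambda M) ->
  exists s, op_generated (xm_act M) [set: G] (kernel (xm_lambda M)) s.
Proof.
move=> fgT nilp; have [sigma [sigmaP sigmaM]] := free_section pi (xm_lambda M).
exact: (xmod_kernel_op_generated free_group_fg presentation_hom_surj
  presentation_kernel_op_generated fgT nilp sigmaP sigmaM).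
Qed.

Lemma tensor_power_rec_fg k :
  (exists s, op_generated (xm_act (tensor_power_rec G k)) [set: G]
     [set: xm_car (tensor_power_rec G k)] s) /\
  finitely_generated (kernel (xm_lambda (tensor_power_rec G k))).
Proof.
have [X genX] := presented_group_fg.
elim: k => [|k [fgT fgJ]].
  (* The index k stands for the (k+1)-fold power: here it is G acting by conjugation, with trivial
     kernel. *)
  split.
    exists X; split=> // L [sgL _] XL g _.
    have : subgroup_gen [set` X] g by rewrite genX.
    exact: subgroup_genS.
  exists [::]; apply/seteqP; split=> [x|].
    move=> x1; have -> : x = 1 := x1.
    by case: (@subgroup_gen_subgroup G [set` [::]]).
  apply: subgroup_genS => //; split=> // x y; rewrite /kernel /= => -> ->.
  by rewrite mulgV.
have fgT' := next_power_op_generated genX fgT.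
split; first exact: fgT'.
apply: (next_power_kernel_fg genX fgJ).
exact: (@nilpotent_xmod_kernel_op_generated (tensor_power_rec G k.+1) k.+1
  fgT' (@lower_central_sub_range G k.+1)).
Qed.

End FinitelyPresented.

Theorem lemma2p2 (G : groupType) (n : nat) :
  finitely_presented G -> 2 <= n -> finitely_generated (kernel (lambda G n)).
Proof.
move=> [m [R [f bij_f]]] _; have [_ [s es]] := tensor_power_rec_fg bij_f n.-1.
(* [lambda] is [xm_lambda] with values in the subgroup type [gamma], and [val] is injective, so the
   kernels agree. *)
exists s; rewrite -es; apply/seteqP; split=> t.
  by move=> /(congr1 val).
by move=> t1; apply: val_inj.
Qed.
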